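(* Let $\eta<\mu<2\eta$ and let $\gamma_2\in(0,\gamma_1)$ satisfy $f_3(\gamma_2)=f_4(\gamma_2)$. (i) If $\gamma\in(\gamma_2,\gamma_1)$, put $$\overline M_\gamma=\frac{1}{1+\delta\bar\eta}\ln\Big[\frac{1}{\delta\bar\eta}\Big\{\frac{g(1)}{c_{2,1}}c_{3,1}(0)-1\Big\}\Big],\qquad b_2=c_{2,1}\Big[\frac{\delta\bar\eta}{1+\delta\bar\eta}\big[e^{\overline M_\gamma[1+\delta\bar\eta]}-1\big]+\overline M_\gamma\Big],\qquad x_{b_2}=\bar f_0(\alpha_\gamma)+b_2 .$$ Then the function $v:[0,\infty)\to\mathbb{R}$, $v(0)=0$, given (and extended by continuity at $b_2$ and $x_{b_2}$) by $$v(x)=\begin{cases}c_{2,1}e^{-\mathsf{x}_1^{-1}(x)}\big[e^{[1+\delta\bar\eta][\overline M_\gamma+\mathsf{x}_1^{-1}(x)]}-1\big],&x\in(0,b_2),\\[1mm] \frac{e^{-\mathsf{x}_2^{-1}(x)}}{\delta+\gamma}\Big\{\frac{g(e^{\mathsf{x}_2^{-1}(x)})e^{\mathsf{x}_2^{-1}(x)}}{\bar\eta}\big[c_{3,1}(0)-\bar\eta[\mu-\eta]H_0(e^{\mathsf{x}_2^{-1}(x)})\big]-[\mu-\eta]\Big\}+\frac{\gamma[v(b_2)+x-b_2]}{\delta+\gamma},&x\in(b_2,x_{b_2}),\\[1mm] c_{3,2}(\alpha_\gamma)e^{\lambda_\gamma[x-x_{b_2}]}+\frac{\gamma}{\gamma+\delta}\big[x-b_2+v(b_2)+\frac{\eta}{\delta+\gamma}\big],&x\in(x_{b_2},\infty),\end{cases}$$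 is a $C^2$, increasing and concave solution on $(0,\infty)$ of the HJB equation (see context), with $b_2=b_2^\gamma:=\inf\{x>0:v'(x)<1\}$. Here $\mathsf{x}_1^{-1}$ is the inverse of $\mathsf{x}_1(z)=\frac{\delta\bar\eta c_{2,1}}{1+\delta\bar\eta}e^{[1+\delta\bar\eta][z+\overline M_\gamma]}+c_{2,1}z+c_{2,1}\big[\overline M_\gamma-\frac{\delta\bar\eta}{1+\delta\bar\eta}\big]$, $z\in[-\overline M_\gamma,0]$, and $\mathsf{x}_2^{-1}$ is the inverse of $\mathsf{x}_2(z)=\bar f_0(e^z)+b_2$, $z\in[0,\ln\alpha_\gamma]$. Furthermore, $v'/v''$ is decreasing on $(0,\infty)$, and $b_1^\gamma:=\inf\{x>0:-\frac{\mu}{\sigma^2}\frac{v'(x)}{v''(x)}\ge1\}=\bar f_0(\alpha_\gamma)+b_2^\gamma$. (ii) If $\gamma\in(0,\gamma_2)$, let $\widehat M_\gamma\in(0,\ln\alpha_\gamma)$ be the unique solution in that interval of $$\frac{\mu-\eta}{e^{\widehat M_\gamma}g(e^{\widehat M_\gamma})}=\frac{\mu}{2\alpha_\gamma g(\alpha_\gamma)}+[\mu-\eta]H_{-\widehat M_\gamma}(\alpha_\gamma),$$ and put $x_0=\hat f_{-\widehat M_\gamma}(\alpha_\gamma)$. Then the function $v:[0,\infty)\to\mathbb{R}$, $v(0)=0$, given (and extended by continuity at $x_0$) by $$v(x)=\begin{cases}\frac{e^{-\mathsf{x}_2^{-1}(x)}}{\delta+\gamma}\Big\{\frac{g(e^{\mathsf{x}_2^{-1}(x)})e^{\mathsf{x}_2^{-1}(x)}}{\bar\eta}\big[c_{3,3}(-\widehat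 M_\gamma)-\bar\eta[\mu-\eta]H_{-\widehat M_\gamma}(e^{\mathsf{x}_2^{-1}(x)})\big]-[\mu-\eta]\Big\}+\frac{\gamma x}{\delta+\gamma},&x\in(0,x_0),\\[1mm] c_{3,2}(\alpha_\gamma)e^{\lambda_\gamma[x-x_0]}+\frac{\gamma}{\gamma+\delta}\big[x+\frac{\eta}{\delta+\gamma}\big],&x\in(x_0,\infty),\end{cases}$$ where $\mathsf{x}_2^{-1}$ is the inverse of $\mathsf{x}_2(z)=\hat f_{-\widehat M_\gamma}(e^z)$, $z\in[\widehat M_\gamma,\ln\alpha_\gamma]$, is a solution of the HJB equation, with $b_2^\gamma:=\inf\{x>0:v'(x)<1\}=0$. Furthermore, $v'/v''$ is decreasing on $(0,\infty)$, and $b_1^\gamma:=\inf\{x>0:-\frac{\mu}{\sigma^2}\frac{v'(x)}{v''(x)}\ge1\}=\hat f_{-\widehat M_\gamma}(\alpha_\gamma)$.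
   Context: Constants: $\mu>\eta>0$, $\sigma>0$, $\delta>0$, $\gamma>0$. HJB equation: $$\max_{0\le u\le 1,\;0\le\xi\le x}\Big\{\tfrac12\sigma^2u^2v''(x)+[\eta-(1-u)\mu]v'(x)-\delta v(x)+\gamma[\xi+v(x-\xi)-v(x)]\Big\}=0\ \ (x>0),\qquad v(0)=0.$$ $\lambda_\gamma$ is the negative root of $\frac{\sigma^2}{2}r^2+\eta r-(\delta+\gamma)=0$. $f_1(\gamma)=\frac{1}{\lambda_\gamma\delta}\big[\delta+\frac{\lambda_\gamma\eta\gamma}{\delta+\gamma}\big]$ for $\gamma>0$ (strictly increasing), and $\gamma_1=f_1^{-1}\big(\frac{2\eta-\mu}{2\delta}\big)$. $\bar\eta=\frac{2\sigma^2}{\mu^2}$, $c_{2,1}=\frac{\bar\eta[\mu-\eta]}{1+\delta\bar\eta}$, $\alpha_\gamma=\frac{\gamma+\delta}{\gamma}\big[1+\frac{\mu}{\sigma^2\lambda_\gamma}\big]$ (one has $\alpha_\gamma>1$ for $\gamma\in(0,\gamma_1)$), $c_{3,2}(\alpha_\gamma)=-\frac{\mu}{\sigma^2\alpha_\gamma\lambda_\gamma^2}$. $g$ is the density of the gamma distribution with shape $\bar\eta[\delta+\gamma]+1$ and rate $\gamma\bar\eta$, i.e. $g(x)=\frac{[\bar\eta\gamma]^{\bar\eta[\delta+\gamma]+1}}{\Gamma(\bar\eta[\delta+\gamma]+1)}x^{\bar\eta[\delta+\gamma]}e^{-\gamma\bar\eta x}$, $x>0$, and $G$ is its cumulative distribution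 function. For $\beta\in\mathbb{R}$ and $z\geq e^{-\beta}$: $H_\beta(z)=\int_{e^{-\beta}}^z\frac{dy}{y^2g(y)}$; $c_{3,1}(\beta)=\frac{\sigma^2}{\mu\alpha_\gamma g(\alpha_\gamma)}+\bar\eta[\mu-\eta]H_\beta(\alpha_\gamma)$; $c_{3,3}(\beta)=\frac{\bar\eta[\mu-\eta]}{e^{-\beta}g(e^{-\beta})}$; $$\bar f_\beta(z)=c_{3,1}(\beta)[G(z)-G(e^{-\beta})]-\bar\eta[\mu-\eta]\Big[G(z)H_\beta(z)-\int_{e^{-\beta}}^z\frac{G(y)}{y^2g(y)}dy\Big],$$ $$\hat f_\beta(z)=c_{3,3}(\beta)[G(z)-G(e^{-\beta})]-\bar\eta[\mu-\eta]\Big[G(z)H_\beta(z)-\int_{e^{-\beta}}^z\frac{G(y)}{y^2g(y)}dy\Big].$$ For $\gamma\in(0,\gamma_1)$, with $f_2(\gamma)=\alpha_\gamma$: $$f_3(\gamma)=\frac{\sigma^2e^{\bar\eta\gamma f_2(\gamma)}}{\mu[f_2(\gamma)]^{\bar\eta[\delta+\gamma]+1}}+\bar\eta[\mu-\eta]\int_1^{f_2(\gamma)}\frac{e^{\bar\eta\gamma y}}{y^{\bar\eta[\delta+\gamma]+2}}dy,\qquad f_4(\gamma)=\bar\eta[\mu-\eta]e^{\bar\eta\gamma}.$$ There is a unique $\gamma_2\in(0,\gamma_1)$ with $f_3(\gamma_2)=f_4(\gamma_2)$, and $f_3>f_4$ on $(\gamma_2,\gamma_1)$. *)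

(* Defs.v *)
From Stdlib Require Export Reals.
From Coquelicot Require Export Coquelicot.
Open Scope R_scope.

(* [iota P] is Coquelicot's definite description: the element satisfying [P]
   whenever there is exactly one. *)

Definition inverse_on (f : R -> R) (a b x : R) : R :=
  iota (fun z => a <= z <= b /\ f z = x).

Definition bijective_between (f : R -> R) (a b c d : R) : Prop :=
  (forall z, a <= z <= b -> c <= f z <= d) /\
  (forall x, c <= x <= d -> exists! z, a <= z <= b /\ f z = x).

Definition Gamma (s : R) : R :=
  RInt_gen (fun t => Rpower t (s - 1) * exp (- t))
           (at_right 0) (Rbar_locally p_infty).

Definition C2_pos (v : R -> R) : Prop :=
  forall x, 0 < x ->
    ex_derive v x /\ ex_derive (Derive v) x /\ continuous (Derive_n v 2) x.

Definition increasing_pos (v : R -> R) : Prop :=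
  forall x y, 0 < x -> x < y -> v x < v y.

Definition concave_pos (v : R -> R) : Prop :=
  forall x y t, 0 < x -> 0 < y -> 0 <= t <= 1 ->
    t * v x + (1 - t) * v y <= v (t * x + (1 - t) * y).

Definition ratio_decreasing_pos (v : R -> R) : Prop :=
  (forall x, 0 < x -> Derive_n v 2 x <> 0) /\
  (forall x y, 0 < x -> x < y ->
     Derive v y / Derive_n v 2 y < Derive v x / Derive_n v 2 x).

Definition b2_threshold (v : R -> R) : Rbar :=
  Glb_Rbar (fun x => 0 < x /\ Derive v x < 1).

Section Model.

Variables mu eta sigma delta : R.

Definition HJB_expr (gamma : R) (v : R -> R) (x u xi : R) : R :=
  / 2 * sigma ^ 2 * u ^ 2 * Derive_n v 2 x
  + (eta - (1 - u) * mu) * Derive v x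
  - delta * v x
  + gamma * (xi + v (x - xi) - v x).

(* Classical solution on [0, oo). Values of [v] on the negative axis are
   irrelevant, since 0 <= x - xi. *)
Definition HJB_solution (gamma : R) (v : R -> R) : Prop :=
  C2_pos v /\
  v 0 = 0 /\
  filterlim v (at_right 0) (locally (v 0)) /\
  forall x, 0 < x ->
    (forall u xi, 0 <= u <= 1 -> 0 <= xi <= x ->
       HJB_expr gamma v x u xi <= 0) /\
    (exists u xi, 0 <= u <= 1 /\ 0 <= xi <= x /\
       HJB_expr gamma v x u xi = 0).

Definition b1_threshold (v : R -> R) : Rbar :=
  Glb_Rbar (fun x => 0 < x /\
    - (mu / sigma ^ 2) * (Derive v x / Derive_n v 2 x) >= 1).

Definition lambda (gamma : R) : R :=
  iota (fun r => r < 0 /\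
    sigma ^ 2 / 2 * r ^ 2 + eta * r - (delta + gamma) = 0).

Definition f1 (gamma : R) : R :=
  1 / (lambda gamma * delta) *
  (delta + lambda gamma * eta * gamma / (delta + gamma)).

(* The inverse of [f1] (on the positive half-line) at (2 eta - mu)/(2 delta). *)
Definition gamma1 : R :=
  iota (fun r => 0 < r /\ f1 r = (2 * eta - mu) / (2 * delta)).

Definition etabar : R := 2 * sigma ^ 2 / mu ^ 2.

Definition c21 : R := etabar * (mu - eta) / (1 + delta * etabar).

Definition alpha (gamma : R) : R :=
  (gamma + delta) / gamma * (1 + mu / (sigma ^ 2 * lambda gamma)).

Definition c32 (gamma a : R) : R :=
  - (mu / (sigma ^ 2 * a * lambda gamma ^ 2)).

Definition g (gamma x : R) : R :=
  if Rlt_dec 0 x then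
    Rpower (etabar * gamma) (etabar * (delta + gamma) + 1)
    / Gamma (etabar * (delta + gamma) + 1)
    * Rpower x (etabar * (delta + gamma)) * exp (- (gamma * etabar * x))
  else 0.

Definition G (gamma z : R) : R := RInt (g gamma) 0 z.

Definition H (gamma beta z : R) : R :=
  RInt (fun y => 1 / (y ^ 2 * g gamma y)) (exp (- beta)) z.

Definition c31 (gamma beta : R) : R :=
  sigma ^ 2 / (mu * alpha gamma * g gamma (alpha gamma))
  + etabar * (mu - eta) * H gamma beta (alpha gamma).

Definition c33 (gamma beta : R) : R :=
  etabar * (mu - eta) / (exp (- beta) * g gamma (exp (- beta))).

Definition fbar (gamma beta z : R) : R :=
  c31 gamma beta * (G gamma z - G gamma (exp (- beta)))
  - etabar * (mu - eta) *
    (G gamma z * H gamma beta z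
     - RInt (fun y => G gamma y / (y ^ 2 * g gamma y)) (exp (- beta)) z).

Definition fhat (gamma beta z : R) : R :=
  c33 gamma beta * (G gamma z - G gamma (exp (- beta)))
  - etabar * (mu - eta) *
    (G gamma z * H gamma beta z
     - RInt (fun y => G gamma y / (y ^ 2 * g gamma y)) (exp (- beta)) z).

Definition f3 (gamma : R) : R :=
  sigma ^ 2 * exp (etabar * gamma * alpha gamma)
  / (mu * Rpower (alpha gamma) (etabar * (delta + gamma) + 1))
  + etabar * (mu - eta) *
    RInt (fun y => exp (etabar * gamma * y)
                   / Rpower y (etabar * (delta + gamma) + 2))
         1 (alpha gamma).

Definition f4 (gamma : R) : R := etabar * (mu - eta) * exp (etabar * gamma).

Definition Mbar (gamma : R) : R :=
  1 / (1 + delta * etabar) *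
  ln (1 / (delta * etabar) * (g gamma 1 / c21 * c31 gamma 0 - 1)).

Definition b2 (gamma : R) : R :=
  c21 * (delta * etabar / (1 + delta * etabar)
         * (exp (Mbar gamma * (1 + delta * etabar)) - 1) + Mbar gamma).

Definition xb2 (gamma : R) : R := fbar gamma 0 (alpha gamma) + b2 gamma.

Definition x1 (gamma z : R) : R :=
  delta * etabar * c21 / (1 + delta * etabar)
    * exp ((1 + delta * etabar) * (z + Mbar gamma))
  + c21 * z + c21 * (Mbar gamma - delta * etabar / (1 + delta * etabar)).

Definition x1_inv (gamma x : R) : R :=
  inverse_on (x1 gamma) (- Mbar gamma) 0 x.

Definition x2_bar (gamma z : R) : R := fbar gamma 0 (exp z) + b2 gamma.

Definition x2_bar_inv (gamma x : R) : R :=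
  inverse_on (x2_bar gamma) 0 (ln (alpha gamma)) x.

Definition x2_hat (gamma M z : R) : R := fhat gamma (- M) (exp z).

Definition x2_hat_inv (gamma M x : R) : R :=
  inverse_on (x2_hat gamma M) M (ln (alpha gamma)) x.

Definition x0 (gamma M : R) : R := fhat gamma (- M) (alpha gamma).

(* The formulas hold on open intervals; the two continuity clauses encode the
   extension by continuity at the junctions and, in particular, determine
   [v (b2 gamma)]. *)
Definition is_candidate_bar (gamma : R) (v : R -> R) : Prop :=
  v 0 = 0 /\
  (forall x, 0 < x < b2 gamma ->
     let z := x1_inv gamma x in
     v x = c21 * exp (- z)
           * (exp ((1 + delta * etabar) * (Mbar gamma + z)) - 1)) /\
  (forall x, b2 gamma < x < xb2 gamma ->
     let z := x2_bar_inv gamma x in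
     v x = exp (- z) / (delta + gamma)
           * (g gamma (exp z) * exp z / etabar
              * (c31 gamma 0 - etabar * (mu - eta) * H gamma 0 (exp z))
              - (mu - eta))
           + gamma * (v (b2 gamma) + x - b2 gamma) / (delta + gamma)) /\
  (forall x, xb2 gamma < x ->
     v x = c32 gamma (alpha gamma) * exp (lambda gamma * (x - xb2 gamma))
           + gamma / (gamma + delta)
             * (x - b2 gamma + v (b2 gamma) + eta / (delta + gamma))) /\
  continuous v (b2 gamma) /\
  continuous v (xb2 gamma).

Definition Mhat_equation (gamma M : R) : Prop :=
  (mu - eta) / (exp M * g gamma (exp M))
  = mu / (2 * alpha gamma * g gamma (alpha gamma))
    + (mu - eta) * H gamma (- M) (alpha gamma).

Definition is_candidate_hat (gamma M : R) (v : R -> R) : Prop :=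
  v 0 = 0 /\
  (forall x, 0 < x < x0 gamma M ->
     let z := x2_hat_inv gamma M x in
     v x = exp (- z) / (delta + gamma)
           * (g gamma (exp z) * exp z / etabar
              * (c33 gamma (- M)
                 - etabar * (mu - eta) * H gamma (- M) (exp z))
              - (mu - eta))
           + gamma * x / (delta + gamma)) /\
  (forall x, x0 gamma M < x ->
     v x = c32 gamma (alpha gamma) * exp (lambda gamma * (x - x0 gamma M))
           + gamma / (gamma + delta) * (x + eta / (delta + gamma))) /\
  continuous v (x0 gamma M).

End Model.

(* Main.v *)
(** In terms of z = 1/v', with risk tolerance q(z) = - v'/v'', the HJB equation
    with the optimal u inside [0, 1] is the linear ODE
    z q' = (1 + etabar (delta + gamma) - etabar gamma z) q - etabar (mu - eta)
    when lump payments are made, and the same ODE with gamma = 0 otherwise.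
    Both are solved explicitly, x is recovered from dx/dz = q/z, and u = 1 is
    reached where q = sigma^2/mu, at z = alpha, beyond which v is
    exponential-affine. Since q increases up to alpha, v'/v'' decreases, and
    the verification argument gives the HJB equation. The two cases are
    separated by the sign of q(1) - etabar (mu - eta), i.e. of f3 - f4; this
    value increases with gamma and vanishes at gamma2. In the first case the
    curve is continued below z = 1 down to x = 0; in the second it starts at
    the z > 1 where q = etabar (mu - eta), which is the condition v(0) = 0. *)

Require Import Defs.
From Stdlib Require Import Reals Ranalysis5 Lra.
From Coquelicot Require Import Coquelicot.
Open Scope R_scope.

(** The linear ODE for q is the HJB equation differentiated. With v' = 1/z the optimised equation
    reads (delta + gamma) v = (q/etabar - (mu - eta))/z + gamma (x + constant), and differentiating
    in z with dx/dz = q/z removes both v and x. Read backwards, the same identity defines v from q.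
    The integrating factor of the ODE is 1/(z g(z)) up to a constant, which is how a gamma density
    enters; its normalising constant cancels everywhere, but only once the improper integral [Gamma]
    is known to be positive. The obstacle is that a candidate v is prescribed on open intervals
    only, through inverses given by definite description, with nothing said about derivatives at the
    junctions. So v itself is not differentiated: a triple (V, D, S) of value, slope and curvature
    is built. Below the exponential tail it comes from curves with parameter -ln v', each run a
    little past both ends so that the derivatives at the junctions are two-sided. The pieces are
    glued, and every candidate is then shown to agree with V on the half-line. *)

(** * One-variable calculus: inverses, parametric curves, gluing *)

Lemma is_derive_continuous (f : R -> R) x l : is_derive f x l -> continuous f x.
Proof.
  intros Hf; apply (ex_derive_continuous f x); exists l; exact Hf.
Qed.

Lemma MVT_is_derive (f df : R -> R) a b :
  a <= b -> (forall x, a <= x <= b -> is_derive f x (df x)) ->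
  exists c, a <= c <= b /\ f b - f a = df c * (b - a).
Proof.
  intros Hab Hf.
  destruct (MVT_gen f a b df) as [c Hc].
  - intros x Hx; rewrite Rmin_left, Rmax_right in Hx by lra; apply Hf; lra.
  - intros x Hx; rewrite Rmin_left, Rmax_right in Hx by lra.
    apply continuity_pt_filterlim, (is_derive_continuous f x (df x)), Hf; lra.
  - rewrite Rmin_left, Rmax_right in Hc by lra; exists c; exact Hc.
Qed.

Lemma is_derive_pos_incr (f df : R -> R) a b :
  a < b -> (forall x, a <= x <= b -> is_derive f x (df x)) ->
  (forall x, a <= x <= b -> 0 < df x) -> f a < f b.
Proof.
  intros Hab Hf Hpos.
  destruct (MVT_is_derive f df a b) as [c [Hc E]]; [lra | exact Hf |].
  specialize (Hpos c Hc); nra.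
Qed.

Lemma is_derive_neg_decr (f df : R -> R) a b :
  a < b -> (forall x, a <= x <= b -> is_derive f x (df x)) ->
  (forall x, a <= x <= b -> df x < 0) -> f b < f a.
Proof.
  intros Hab Hf Hneg.
  destruct (MVT_is_derive f df a b) as [c [Hc E]]; [lra | exact Hf |].
  specialize (Hneg c Hc); nra.
Qed.

Lemma IVT_segment (f : R -> R) a b y :
  a <= b -> (forall x, a <= x <= b -> continuous f x) ->
  f a <= y <= f b -> exists x, a <= x <= b /\ f x = y.
Proof.
  intros Hab Hc Hy.
  destruct (Req_dec (f a) y) as [E | Na]; [exists a; split; [lra | exact E] |].
  destruct (Req_dec (f b) y) as [E | Nb]; [exists b; split; [lra | exact E] |].
  assert (a <> b) by (intros E; subst; lra).
  destruct (IVT_interv (fun x => f x - y) a b) as [x [Hx E]]; try lra.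
  - intros x Hx; apply continuity_pt_minus.
    + apply continuity_pt_filterlim, Hc, Hx.
    + apply continuity_pt_const; intros u v; reflexivity.
  - exists x; split; [exact Hx | lra].
Qed.

Definition increasing_on (f : R -> R) (a b : R) : Prop :=
  forall x y, a <= x -> x < y -> y <= b -> f x < f y.

Lemma inverse_on_eq f a b z :
  increasing_on f a b -> a <= z <= b -> inverse_on f a b (f z) = z.
Proof.
  intros Hf Hz; unfold inverse_on.
  apply (iota_unique (V := R_CompleteNormedModule)); [| split; [exact Hz | reflexivity]].
  intros y [Hy E].
  destruct (Rtotal_order y z) as [L | [L | L]]; [| exact L |];
    [specialize (Hf y z) | specialize (Hf z y)]; lra.
Qed.

Lemma increasing_on_bijective f a b :
  a <= b -> increasing_on f a b -> (forall x, a <= x <= b -> continuous f x) ->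
  bijective_between f a b (f a) (f b).
Proof.
  intros Hab Hf Hc.
  assert (Hle : forall x y, a <= x -> x <= y -> y <= b -> f x <= f y).
  { intros x y Hx [L | <-] Hy; [left; apply Hf; lra | lra]. }
  split.
  - intros z Hz; split; apply Hle; lra.
  - intros x Hx; destruct (IVT_segment f a b x Hab Hc Hx) as [z [Hz E]].
    exists z; split; [split; assumption |].
    intros y [Hy E']; rewrite <- (inverse_on_eq f a b z), <- (inverse_on_eq f a b y)
      by assumption; congruence.
Qed.

(** Only interior points are allowed: outside [f a, f b] the description in [inverse_on] has no
    solution, so nothing is known about its values there. *)
Lemma is_derive_inverse_on (f df : R -> R) a b z :
  (forall t, a <= t <= b -> is_derive f t (df t)) ->
  (forall t, a <= t <= b -> 0 < df t) -> a < z < b ->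
  is_derive (inverse_on f a b) (f z) (/ df z).
Proof.
  intros Hd Hp Hz.
  assert (Hi : increasing_on f a b).
  { intros x y Hx Hxy Hy; apply (is_derive_pos_incr f df); [exact Hxy | |];
      intros t Ht; [apply Hd | apply Hp]; lra. }
  assert (Hc : forall x, a <= x <= b -> continuous f x).
  { intros x Hx; apply (is_derive_continuous f x (df x)), Hd, Hx. }
  assert (Hbij := increasing_on_bijective f a b ltac:(lra) Hi Hc).
  assert (Hab : f a < f b) by (apply Hi; lra).
  assert (Hfz : f a < f z < f b) by (split; apply Hi; lra).
  assert (Hinv : forall x, f a <= x <= f b ->
     a <= inverse_on f a b x <= b /\ f (inverse_on f a b x) = x).
  { intros x Hx; destruct (proj2 Hbij x Hx) as [y [[Hy <-] _]].
    rewrite inverse_on_eq by assumption; split; [exact Hy | reflexivity]. }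
  set (J := inverse_on f a b) in *.
  assert (EJ : forall t, a <= t <= b -> J (f t) = t).
  { intros t Ht; apply inverse_on_eq; assumption. }
  assert (prf : forall t, J (f a) <= t <= J (f b) -> derivable_pt f t).
  { intros t Ht; rewrite !EJ in Ht by lra.
    exists (df t); apply is_derive_Reals, Hd, Ht. }
  assert (Hz' : J (f a) <= J (f z) <= J (f b)) by (rewrite !EJ by lra; lra).
  assert (Ed : derive_pt f (J (f z)) (prf _ Hz') = df z).
  { apply derive_pt_eq_0; rewrite EJ by lra; apply is_derive_Reals, Hd; lra. }
  replace (/ df z) with (1 / derive_pt f (J (f z)) (prf _ Hz'))
    by (rewrite Ed; unfold Rdiv; ring).
  apply is_derive_Reals.
  apply (derivable_pt_lim_recip_interv f J (f a) (f b) (f z) prf);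
    [| exact Hab | exact Hfz | |].
  - apply (continuity_pt_recip_interv f J a b); try lra.
    + intros x y; apply Hi.
    + intros x Hx Hx'; exact (proj2 (Hinv x (conj Hx Hx'))).
    + intros x Hx Hx'; exact (proj1 (Hinv x (conj Hx Hx'))).
    + intros t Ht; apply continuity_pt_filterlim, Hc, Ht.
  - intros x Hx; exact (proj2 (Hinv x Hx)).
  - rewrite Ed; specialize (Hp z); lra.
Qed.

Definition C2_on (A : R -> Prop) (V D S : R -> R) : Prop :=
  forall x, A x -> is_derive V x (D x) /\ is_derive D x (S x) /\ continuous S x.

(* The curve z |-> (phi z, W z) is the graph of a function V with V' = e^{-z},
   where z = phi^{-1}(x). *)
Lemma C2_on_parametric_curve (phi q W : R -> R) a' a b b' :
  a' < a -> a <= b -> b < b' ->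
  (forall z, a' <= z <= b' -> is_derive phi z (q z)) ->
  (forall z, a' <= z <= b' -> 0 < q z) ->
  (forall z, a' <= z <= b' -> continuous q z) ->
  (forall z, a' <= z <= b' -> is_derive W z (exp (- z) * q z)) ->
  exists V D S, C2_on (fun x => phi a <= x <= phi b) V D S /\
    forall z, a <= z <= b ->
      V (phi z) = W z /\ D (phi z) = exp (- z) /\ S (phi z) = - (exp (- z) / q z).
Proof.
  intros Ha Hab Hb Hphi Hq Hqc HW.
  (* The inverse is taken on the larger interval, so that all of [a, b] is interior and J is
     differentiable from both sides even at [phi a] and [phi b]. *)
  set (J := inverse_on phi a' b').
  assert (Hi : increasing_on phi a' b').
  { intros x y Hx Hxy Hy; apply (is_derive_pos_incr phi q); [exact Hxy | |];
      intros t Ht; [apply Hphi | apply Hq]; lra. }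
  assert (EJ : forall z, a' <= z <= b' -> J (phi z) = z).
  { intros z Hz; apply inverse_on_eq; assumption. }
  assert (HJ : forall z, a <= z <= b -> is_derive J (phi z) (/ q z)).
  { intros z Hz; apply is_derive_inverse_on; [exact Hphi | exact Hq | lra]. }
  exists (fun x => W (J x)), (fun x => exp (- J x)),
    (fun x => - (exp (- J x) / q (J x))); split.
  - intros x Hx.
    destruct (IVT_segment phi a b x Hab) as [z [Hz <-]]; [| exact Hx |].
    { intros t Ht; apply (is_derive_continuous phi t (q t)), Hphi; lra. }
    assert (Hqz : 0 < q z) by (apply Hq; lra).
    assert (HDJ : is_derive (fun x => exp (- J x)) (phi z) (- (exp (- J (phi z)) / q (J (phi z))))).
    { rewrite EJ by lra.
      evar_last.
      - apply (is_derive_comp (fun t => exp (- t)) J); [| apply HJ, Hz].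
        rewrite EJ by lra; auto_derive; [exact I | reflexivity].
      - unfold scal; simpl; unfold mult; simpl; field; lra. }
    split; [| split; [exact HDJ |]].
    + evar_last.
      * apply (is_derive_comp W J); [| apply HJ, Hz].
        rewrite EJ by lra; apply HW; lra.
      * rewrite EJ by lra; unfold scal; simpl; unfold mult; simpl; field; lra.
    + assert (HcJ : continuous J (phi z)) by (apply (is_derive_continuous J _ _ (HJ z Hz))).
      apply (continuous_opp (fun x => exp (- J x) / q (J x))).
      apply (continuous_mult (fun x => exp (- J x)) (fun x => / q (J x))).
      * apply (is_derive_continuous _ _ _ HDJ).
      * apply (continuous_comp J (fun t => / q t)); [exact HcJ |].
        rewrite EJ by lra.
        apply (continuous_comp q Rinv); [apply Hqc; lra |].
        apply continuity_pt_filterlim, continuity_pt_inv;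
          [apply derivable_continuous_pt, derivable_pt_id | unfold id; lra].
  - intros z Hz; rewrite EJ by lra; repeat split.
Qed.

Definition glue (c : R) (f1 f2 : R -> R) (x : R) : R :=
  if Rle_dec x c then f1 x else f2 x.

Lemma glue_left c f1 f2 x : x <= c -> glue c f1 f2 x = f1 x.
Proof. intros Hx; unfold glue; destruct (Rle_dec x c); [reflexivity | lra]. Qed.

Lemma glue_right c f1 f2 x : f1 c = f2 c -> c <= x -> glue c f1 f2 x = f2 x.
Proof.
  intros E Hx; unfold glue; destruct (Rle_dec x c); [| reflexivity].
  replace x with c by lra; exact E.
Qed.

Lemma continuous_glue c (f1 f2 : R -> R) x :
  f1 c = f2 c -> (x <= c -> continuous f1 x) -> (c <= x -> continuous f2 x) ->
  continuous (glue c f1 f2) x.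
Proof.
  intros E H1 H2.
  destruct (Rtotal_order x c) as [L | [-> | L]].
  - apply (continuous_ext_loc _ f1); [| apply H1; lra].
    apply (filter_imp (fun t => t < c)); [intros t Ht; symmetry; apply glue_left; lra |].
    apply open_lt, L.
  - apply filterlim_locally; intros eps.
    rewrite glue_left by lra.
    assert (C1 := H1 ltac:(lra)); assert (C2 := H2 ltac:(lra)).
    unfold continuous in C1, C2; rewrite filterlim_locally in C1, C2.
    rewrite <- E in C2.
    generalize (filter_and _ _ (C1 eps) (C2 eps)).
    apply filter_imp; intros t [A B]; unfold glue; destruct (Rle_dec t c); assumption.
  - apply (continuous_ext_loc _ f2); [| apply H2; lra].
    apply (filter_imp (fun t => c < t));
      [intros t Ht; symmetry; apply glue_right; [exact E | lra] |].
    apply open_gt, L.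
Qed.

Lemma is_derive_glue c (f1 f2 : R -> R) x l1 l2 :
  f1 c = f2 c -> (x = c -> l1 = l2) ->
  (x <= c -> is_derive f1 x l1) -> (c <= x -> is_derive f2 x l2) ->
  is_derive (glue c f1 f2) x (if Rle_dec x c then l1 else l2).
Proof.
  intros E El H1 H2.
  destruct (Rtotal_order x c) as [L | [-> | L]].
  - destruct (Rle_dec x c); [| lra].
    apply (is_derive_ext_loc f1); [| apply H1; lra].
    apply (filter_imp (fun t => t < c)); [intros t Ht; symmetry; apply glue_left; lra |].
    apply open_lt, L.
  - destruct (Rle_dec c c); [| lra].
    assert (D1 := H1 ltac:(lra)); assert (D2 := H2 ltac:(lra)).
    rewrite <- (El eq_refl) in D2.
    apply is_derive_Reals in D1; apply is_derive_Reals in D2; apply is_derive_Reals.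
    intros eps Heps; destruct (D1 eps Heps) as [d1 B1], (D2 eps Heps) as [d2 B2].
    assert (Hd : 0 < Rmin d1 d2) by (apply Rmin_pos; apply cond_pos).
    exists (mkposreal _ Hd); simpl; intros h Hh0 Hh.
    rewrite (glue_left c f1 f2 c) by lra.
    destruct (Rle_dec (c + h) c).
    + rewrite glue_left by lra; apply B1; [exact Hh0 |].
      eapply Rlt_le_trans; [exact Hh | apply Rmin_l].
    + rewrite glue_right by (exact E || lra); rewrite E; apply B2; [exact Hh0 |].
      eapply Rlt_le_trans; [exact Hh | apply Rmin_r].
  - destruct (Rle_dec x c); [lra |].
    apply (is_derive_ext_loc f2); [| apply H2; lra].
    apply (filter_imp (fun t => c < t));
      [intros t Ht; symmetry; apply glue_right; [exact E | lra] |].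
    apply open_gt, L.
Qed.

(** Each piece has two-sided derivatives at c when c belongs to its domain, so equality of V, D and
    S at c is all that is needed for the pasted function to be C2 there. The new domain asks for A1
    to the left of c and A2 to the right, hence for both at c. *)
Lemma C2_on_glue c (A1 A2 : R -> Prop) V1 D1 S1 V2 D2 S2 :
  V1 c = V2 c -> D1 c = D2 c -> S1 c = S2 c ->
  C2_on A1 V1 D1 S1 -> C2_on A2 V2 D2 S2 ->
  C2_on (fun x => (x <= c -> A1 x) /\ (c <= x -> A2 x))
    (glue c V1 V2) (glue c D1 D2) (glue c S1 S2).
Proof.
  intros EV ED ES H1 H2 x [HA1 HA2]; split; [| split].
  - apply (is_derive_glue c V1 V2 x (D1 x) (D2 x)); [exact EV | intros ->; exact ED | |];
      intros Hx; [apply H1 | apply H2]; auto.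
  - apply (is_derive_glue c D1 D2 x (S1 x) (S2 x)); [exact ED | intros ->; exact ES | |];
      intros Hx; [apply H1 | apply H2]; auto.
  - apply continuous_glue; [exact ES | |]; intros Hx; [apply H1 | apply H2]; auto.
Qed.

(** Pins down a candidate at a junction, where its formulas are silent: the value is the limit from
    the left. *)
Lemma continuous_eq_left (f h : R -> R) a c :
  a < c -> (forall x, a < x < c -> f x = h x) ->
  continuous f c -> continuous h c -> f c = h c.
Proof.
  intros Hac E Hf Hh.
  apply (filterlim_locally_unique (F := at_left c) f).
  - intros P HP; generalize (Hf P HP).
    unfold filtermap, at_left, within; apply filter_imp; auto.
  - apply (filterlim_ext_loc h).
    + unfold at_left, within; apply (filter_imp (fun t => a < t)).
      * intros t Ht Htc; symmetry; apply E; lra.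
      * apply open_gt, Hac.
    + intros P HP; generalize (Hh P HP).
    unfold filtermap, at_left, within; apply filter_imp; auto.
Qed.
(** * Verification *)

Lemma Glb_Rbar_min (E : R -> Prop) m :
  (forall x, E x -> m <= x) -> E m -> Glb_Rbar E = Finite m.
Proof.
  intros Hlb Hm; apply is_glb_Rbar_unique; split.
  - intros x Hx; simpl; apply Hlb, Hx.
  - intros l Hl; apply (Hl m Hm).
Qed.

(** Serves [b2_threshold], whose set is an open ray that misses its infimum. The set of
    [b1_threshold] contains its infimum, so [Glb_Rbar_min] suffices there. *)
Lemma Glb_Rbar_open_ray (E : R -> Prop) m :
  (forall x, E x <-> m < x) -> Glb_Rbar E = Finite m.
Proof.
  intros HE; apply is_glb_Rbar_unique; split.
  - intros x Hx; apply HE in Hx; simpl; lra.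
  - intros [l | |] Hl; simpl; [| apply (Hl (m + 1)), HE; lra | exact I].
    apply Rnot_lt_le; intros Hlt.
    assert (Hm : E ((m + l) / 2)) by (apply HE; lra).
    specialize (Hl _ Hm); simpl in Hl; lra.
Qed.

Section Verification.

Variables mu eta sigma delta gamma b X : R.
Variables V D S : R -> R.
Hypothesis Hmu : 0 < mu.
Hypothesis Hsigma : 0 < sigma.
Hypothesis Hgamma : 0 < gamma.
Hypothesis Hb : 0 <= b.
Hypothesis HbX : b < X.
Hypothesis HV0 : V 0 = 0.
Hypothesis HC2 : C2_on (fun x => 0 <= x) V D S.
Hypothesis HD : forall x, 0 <= x -> 0 < D x.
Hypothesis HS : forall x, 0 <= x -> S x < 0.
Hypothesis Hratio : forall x y, 0 <= x -> x < y -> D y / S y < D x / S x.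
Hypothesis HratioX : D X / S X = - (sigma ^ 2 / mu).
(** Two conditions cover both cases: a positive b is the point where the slope equals 1, whereas for
    b = 0 the slope at the origin may already be below 1. *)
Hypothesis HDb_le : D b <= 1.
Hypothesis HDb_eq : 0 < b -> D b = 1.

(** The maximum of xi + V (x - xi) - V x over 0 <= xi <= x. As V x - x increases up to b and
    decreases afterwards, the best payment brings the surplus down to b, or is 0 if the surplus is
    not above b. *)
Definition lump_gain (x : R) : R :=
  if Rle_dec x b then 0 else x - b + V b - V x.

(* The equations are those obtained after optimising over u: the interior
   optimum is u = - mu D / (sigma^2 S), and u = 1 beyond X. *)
Hypothesis Hode_interior : forall x, 0 < x <= X ->
  - (mu ^ 2 / (2 * sigma ^ 2)) * (D x ^ 2 / S x) - (mu - eta) * D x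
    - delta * V x + gamma * lump_gain x = 0.
Hypothesis Hode_tail : forall x, X <= x ->
  / 2 * sigma ^ 2 * S x + eta * D x - delta * V x + gamma * lump_gain x = 0.

(** A candidate is unconstrained on the negative axis, so it is compared with V on the half-line
    only; derivatives at x > 0 are transferred by locality. *)
Variable v : R -> R.
Hypothesis Hv : forall x, 0 <= x -> v x = V x.

Lemma D_decreasing x y : 0 <= x -> x < y -> D y < D x.
Proof.
  intros Hx Hxy; apply (is_derive_neg_decr D S); [exact Hxy | |];
    intros t Ht; [apply HC2 | apply HS]; lra.
Qed.

Lemma D_after x : b < x -> D x < 1.
Proof. intros Hx; assert (A := D_decreasing b x Hb Hx); lra. Qed.

Lemma D_before x : 0 < b -> 0 <= x <= b -> 1 <= D x.
Proof.
  intros Hb0 [Hx [L | ->]]; [| rewrite (HDb_eq Hb0); lra].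
  assert (A := D_decreasing x b Hx L); rewrite (HDb_eq Hb0) in A; lra.
Qed.

Lemma locally_pos_eq x : 0 < x -> locally x (fun t => V t = v t).
Proof.
  intros Hx; apply (filter_imp (fun t => 0 < t)).
  - intros t Ht; symmetry; apply Hv; lra.
  - apply open_gt, Hx.
Qed.

Lemma is_derive_v x : 0 < x -> is_derive v x (D x).
Proof.
  intros Hx; apply (is_derive_ext_loc V).
  - apply locally_pos_eq, Hx.
  - apply HC2; lra.
Qed.

Lemma Derive_v x : 0 < x -> Derive v x = D x.
Proof. intros Hx; apply is_derive_unique, is_derive_v, Hx. Qed.

Lemma is_derive_Derive_v x : 0 < x -> is_derive (Derive v) x (S x).
Proof.
  intros Hx; apply (is_derive_ext_loc D).
  - apply (filter_imp (fun t => 0 < t)).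
    + intros t Ht; symmetry; apply Derive_v, Ht.
    + apply open_gt, Hx.
  - apply HC2; lra.
Qed.

Lemma Derive2_v x : 0 < x -> Derive_n v 2 x = S x.
Proof. intros Hx; simpl; apply is_derive_unique, is_derive_Derive_v, Hx. Qed.

Lemma verification_C2 : C2_pos v.
Proof.
  intros x Hx; split; [| split].
  - exists (D x); apply is_derive_v, Hx.
  - exists (S x); apply is_derive_Derive_v, Hx.
  - apply (continuous_ext_loc _ S); [| apply HC2; lra].
    apply (filter_imp (fun t => 0 < t)).
    + intros t Ht; symmetry; apply Derive2_v, Ht.
    + apply open_gt, Hx.
Qed.

Lemma verification_increasing : increasing_pos v.
Proof.
  intros x y Hx Hxy; apply (is_derive_pos_incr v D); [exact Hxy | |];
    intros t Ht; [apply is_derive_v | apply HD]; lra.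
Qed.

Lemma below_tangent p y : 0 < p -> 0 < y -> v y <= v p + D p * (y - p).
Proof.
  intros Hp Hy; destruct (Rtotal_order y p) as [L | [-> | L]].
  - destruct (MVT_is_derive v D y p) as [c [Hc E]]; [lra | |].
    { intros t Ht; apply is_derive_v; lra. }
    assert (D p <= D c).
    { destruct (proj2 Hc) as [L' | ->]; [left; apply D_decreasing; lra | lra]. }
    nra.
  - lra.
  - destruct (MVT_is_derive v D p y) as [c [Hc E]]; [lra | |].
    { intros t Ht; apply is_derive_v; lra. }
    assert (D c <= D p).
    { destruct (proj1 Hc) as [L' | <-]; [left; apply D_decreasing; lra | lra]. }
    nra.
Qed.

Lemma verification_concave : concave_pos v.
Proof.
  intros x y t Hx Hy Ht.
  set (p := t * x + (1 - t) * y).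
  assert (Hp : 0 < p) by (unfold p; destruct (Req_dec t 0); [subst; lra | nra]).
  assert (Tx := below_tangent p x Hp Hx); assert (Ty := below_tangent p y Hp Hy).
  (* Both points are bounded by the tangent at p; the linear terms cancel because p is their
     barycentre. *)
  assert (E : t * (D p * (x - p)) + (1 - t) * (D p * (y - p)) = 0)
    by (unfold p; ring).
  nra.
Qed.

Lemma lump_gain_ge x xi :
  0 < x -> 0 <= xi <= x -> xi + V (x - xi) - V x <= lump_gain x.
Proof.
  intros Hx Hxi; unfold lump_gain.
  assert (Hup : forall s t, 0 <= s -> s <= t -> t <= b -> V s - s <= V t - t).
  { intros s t Hs Hst Htb.
    destruct (MVT_is_derive V D s t) as [c [Hc E]]; [lra | |].
    { intros r Hr; apply HC2; lra. }
    destruct (Req_dec s t) as [-> | Hn]; [lra |].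
    assert (1 <= D c) by (apply D_before; lra).
    nra. }
  assert (Hdown : forall s t, b <= s -> s <= t -> V t - t <= V s - s).
  { intros s t Hs Hst.
    destruct (MVT_is_derive V D s t) as [c [Hc E]]; [lra | |].
    { intros r Hr; apply HC2; lra. }
    assert (D c <= 1).
    { destruct (Req_dec c b) as [-> | Hcb]; [exact HDb_le | left; apply D_after; lra]. }
    nra. }
  destruct (Rle_dec x b).
  - assert (A := Hup (x - xi) x); lra.
  - destruct (Rle_dec (x - xi) b).
    + assert (A := Hup (x - xi) b); lra.
    + assert (A := Hdown b (x - xi)); lra.
Qed.

Lemma lump_gain_attained x :
  0 < x -> exists xi, 0 <= xi <= x /\ xi + V (x - xi) - V x = lump_gain x.
Proof.
  intros Hx; unfold lump_gain; destruct (Rle_dec x b).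
  - exists 0; rewrite Rminus_0_r; lra.
  - exists (x - b); replace (x - (x - b)) with b by ring; lra.
Qed.

Definition generator (x u : R) : R :=
  / 2 * sigma ^ 2 * u ^ 2 * S x + (eta - (1 - u) * mu) * D x.

Lemma HJB_expr_v x u xi :
  0 < x -> 0 <= xi <= x ->
  HJB_expr mu eta sigma delta gamma v x u xi
  = generator x u - delta * V x + gamma * (xi + V (x - xi) - V x).
Proof.
  intros Hx Hxi; unfold HJB_expr, generator.
  rewrite Derive_v, Derive2_v, !Hv by lra; reflexivity.
Qed.

(** Completing the square in u. Since S < 0, the square both bounds the expression from above and
    shows where the bound is attained. *)
Lemma generator_interior x u :
  0 <= x -> generator x u
  = - (mu ^ 2 / (2 * sigma ^ 2)) * (D x ^ 2 / S x) - (mu - eta) * D x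
    + / 2 * sigma ^ 2 * S x * (u + mu / sigma ^ 2 * (D x / S x)) ^ 2.
Proof. intros Hx; assert (HSx := HS x Hx); unfold generator; field; lra. Qed.

(** Beyond X the unconstrained maximiser -mu D / (sigma^2 S) is at least 1, so the concave quadratic
    in u is still increasing up to u = 1. *)
Lemma generator_tail x u :
  X <= x -> u <= 1 ->
  generator x u <= / 2 * sigma ^ 2 * S x + eta * D x.
Proof.
  intros Hx Hu; unfold generator.
  assert (HSx := HS x ltac:(lra)).
  assert (Hr : D x / S x <= - (sigma ^ 2 / mu)).
  { destruct Hx as [L | <-]; [| lra].
    rewrite <- HratioX; left; apply Hratio; lra. }
  assert (HmuD : - (sigma ^ 2 * S x) <= mu * D x).
  { assert (E : mu * D x = mu * S x * (D x / S x)) by (field; lra).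
    assert (E' : sigma ^ 2 * S x = mu * S x * (sigma ^ 2 / mu)) by (field; lra).
    rewrite E, E'; assert (mu * S x < 0) by nra; nra. }
  assert (0 < sigma ^ 2) by nra.
  assert (Hneg : sigma ^ 2 * S x < 0) by nra.
  (* This product is the right side minus the left side of the goal. *)
  assert (0 <= (1 - u) * (mu * D x + / 2 * (sigma ^ 2 * S x) * (1 + u))).
  { apply Rmult_le_pos; [lra |]; nra. }
  nra.
Qed.

Lemma verification_HJB : HJB_solution mu eta sigma delta gamma v.
Proof.
  split; [exact verification_C2 |]; split; [rewrite Hv by lra; exact HV0 |]; split.
  - rewrite (Hv 0 (Rle_refl 0)).
    apply (filterlim_ext_loc V).
    + unfold at_right, within; apply filter_forall; intros t Ht.
      symmetry; apply Hv; lra.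
    + intros P HP.
      generalize (is_derive_continuous V 0 (D 0) (proj1 (HC2 0 ltac:(lra))) P HP).
      unfold filtermap, at_right, within; apply filter_imp; auto.
  - intros x Hx; split.
    + intros u xi Hu Hxi; rewrite HJB_expr_v by assumption.
      assert (HL := lump_gain_ge x xi Hx Hxi).
      assert (gamma * (xi + V (x - xi) - V x) <= gamma * lump_gain x) by nra.
      destruct (Rle_dec x X) as [L | L].
      * rewrite generator_interior by lra.
        assert (Ho := Hode_interior x (conj Hx L)); assert (HSx := HS x ltac:(lra)).
        assert (0 <= (u + mu / sigma ^ 2 * (D x / S x)) ^ 2) by apply pow2_ge_0.
        assert (0 < / 2 * sigma ^ 2 * - S x).
        { assert (0 < sigma ^ 2) by (apply pow_lt, Hsigma).
          apply Rmult_lt_0_compat; lra. }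
        nra.
      * assert (Ho := Hode_tail x ltac:(lra)).
        assert (HG := generator_tail x u ltac:(lra) ltac:(lra)); lra.
    + destruct (lump_gain_attained x Hx) as [xi [Hxi E]].
      destruct (Rle_dec x X) as [L | L].
      (* The zero of the square in [generator_interior]; it is at most 1 because D/S decreases and
         equals -sigma^2/mu at X. *)
      * exists (- (mu / sigma ^ 2 * (D x / S x))), xi.
        assert (HSx := HS x ltac:(lra)); assert (HDx := HD x ltac:(lra)).
        assert (Hr : - (sigma ^ 2 / mu) <= D x / S x).
        { destruct L as [L | ->]; [| lra].
          rewrite <- HratioX; left; apply Hratio; lra. }
        assert (Hr0 : D x / S x < 0) by (apply Rmult_pos_neg; [lra | apply Rinv_lt_0_compat, HSx]).
        assert (Hc : 0 < mu / sigma ^ 2) by (apply Rdiv_lt_0_compat; nra).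
        assert (E1 : mu / sigma ^ 2 * (sigma ^ 2 / mu) = 1) by (field; lra).
        split; [nra |]; split; [exact Hxi |].
        rewrite HJB_expr_v, E, generator_interior by (assumption || lra).
        assert (Ho := Hode_interior x (conj Hx L)).
        replace (- (mu / sigma ^ 2 * (D x / S x)) + mu / sigma ^ 2 * (D x / S x)) with 0 by ring.
        lra.
      * exists 1, xi; split; [lra |]; split; [exact Hxi |].
        rewrite HJB_expr_v, E by assumption.
        assert (Ho := Hode_tail x ltac:(lra)); unfold generator; lra.
Qed.

Lemma verification_b2 : b2_threshold v = Finite b.
Proof.
  apply Glb_Rbar_open_ray; intros x; split.
  - intros [Hx Hlt]; rewrite Derive_v in Hlt by exact Hx.
    apply Rnot_le_lt; intros L.
    assert (A := D_before x ltac:(lra) ltac:(lra)); lra.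
  - intros Hx; split; [lra |]; rewrite Derive_v by lra; apply D_after, Hx.
Qed.

Lemma verification_ratio : ratio_decreasing_pos v.
Proof.
  split.
  - intros x Hx; rewrite Derive2_v by exact Hx.
    assert (A := HS x ltac:(lra)); lra.
  - intros x y Hx Hxy; rewrite !Derive_v, !Derive2_v by lra; apply Hratio; lra.
Qed.

Lemma verification_b1 : b1_threshold mu sigma v = Finite X.
Proof.
  assert (Hc : 0 < mu / sigma ^ 2) by (apply Rdiv_lt_0_compat; nra).
  assert (E1 : mu / sigma ^ 2 * (sigma ^ 2 / mu) = 1) by (field; lra).
  apply Glb_Rbar_min.
  - intros x [Hx Hge]; rewrite Derive_v, Derive2_v in Hge by exact Hx.
    apply Rnot_lt_le; intros L; assert (A := Hratio x X ltac:(lra) L).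
    rewrite HratioX in A; nra.
  - split; [lra |]; rewrite Derive_v, Derive2_v, HratioX by lra; lra.
Qed.

Lemma verification :
  C2_pos v /\ increasing_pos v /\ concave_pos v /\
  HJB_solution mu eta sigma delta gamma v /\
  b2_threshold v = Finite b /\ ratio_decreasing_pos v /\
  b1_threshold mu sigma v = Finite X.
Proof.
  exact (conj verification_C2 (conj verification_increasing (conj verification_concave
    (conj verification_HJB (conj verification_b2 (conj verification_ratio verification_b1)))))).
Qed.

End Verification.
(** * The gamma function at positive arguments *)

(** From ln s <= s - 1 at s = t/(2k): half of the exponential decay absorbs the power and the other
    half stays integrable. *)
Lemma Rpower_exp_bound k t :
  0 < k -> 0 < t -> Rpower t k * exp (- t) <= exp (k * ln (2 * k) - k) * exp (- (t / 2)).
Proof.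
  intros Hk Ht; unfold Rpower; rewrite <- !exp_plus.
  assert (L : ln (t / (2 * k)) <= t / (2 * k) - 1).
  { assert (E := exp_ineq1_le (ln (t / (2 * k)))).
    rewrite exp_ln in E by (apply Rdiv_lt_0_compat; lra); lra. }
  rewrite ln_div in L by lra.
  assert (A : k * (ln t - ln (2 * k)) <= t / 2 - k).
  { replace (t / 2 - k) with (k * (t / (2 * k) - 1)) by (field; lra).
    apply Rmult_le_compat_l; lra. }
  assert (B : k * ln t + - t <= k * ln (2 * k) - k + - (t / 2)) by lra.
  destruct B as [B | ->]; [left; apply exp_increasing, B | right; reflexivity].
Qed.

Lemma Gamma_integrand_continuous k t :
  0 < t -> continuous (fun t => Rpower t k * exp (- t)) t.
Proof.
  intros Ht; apply (ex_derive_continuous (fun t => Rpower t k * exp (- t))).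
  unfold Rpower; auto_derive; exact Ht.
Qed.

(** For a positive integrand the integrals over compact intervals grow with the interval, so their
    supremum is the limit at both ends. It is positive because it dominates the integral over
    [1, 2]. *)
Lemma is_RInt_gen_sup (f : R -> R) B :
  (forall t, 0 < t -> continuous f t) -> (forall t, 0 < t -> 0 < f t) ->
  (forall a b, 0 < a -> a <= b -> RInt f a b <= B) ->
  exists l, 0 < l /\ is_RInt_gen f (at_right 0) (Rbar_locally p_infty) l.
Proof.
  intros Hc Hf HB.
  assert (Hex : forall a b, 0 < a -> 0 < b -> ex_RInt f a b).
  { intros a b Ha Hb; apply (ex_RInt_continuous f); intros z Hz; apply Hc.
    assert (0 < Rmin a b) by (apply Rmin_pos; assumption); lra. }
  set (E := fun r => exists a b, 0 < a /\ a <= b /\ r = RInt f a b).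
  destruct (completeness E) as [l [Hub Hlub]].
  - exists B; intros r [a [b [Ha [Hab ->]]]]; apply HB; assumption.
  - exists (RInt f 1 1), 1, 1; split; [lra | split; [lra | reflexivity]].
  - assert (Hsub : forall a a0 b0 b, 0 < a -> a <= a0 -> a0 <= b0 -> b0 <= b ->
        RInt f a0 b0 <= RInt f a b).
    { intros a a0 b0 b H0 H1 H2 H3.
      assert (C1 : RInt f a a0 + RInt f a0 b = RInt f a b)
        by (apply (RInt_Chasles f); apply Hex; lra).
      assert (C2 : RInt f a0 b0 + RInt f b0 b = RInt f a0 b)
        by (apply (RInt_Chasles f); apply Hex; lra).
      assert (0 <= RInt f a a0).
      { apply RInt_ge_0; [lra | apply Hex; lra |]; intros t Ht; left; apply Hf; lra. }
      assert (0 <= RInt f b0 b).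
      { apply RInt_ge_0; [lra | apply Hex; lra |]; intros t Ht; left; apply Hf; lra. }
      lra. }
    exists l; split.
    + apply Rlt_le_trans with (RInt f 1 2).
      * apply RInt_gt_0; [lra | |]; intros t Ht; [apply Hf | apply Hc]; lra.
      * apply Hub; exists 1, 2; split; [lra | split; [lra | reflexivity]].
    + intros P [eps HP].
      assert (Happ : exists a0 b0, 0 < a0 /\ a0 <= b0 /\ l - eps < RInt f a0 b0).
      { destruct (Classical_Prop.classic
          (exists a0 b0, 0 < a0 /\ a0 <= b0 /\ l - eps < RInt f a0 b0)) as [Y | N];
          [exact Y |].
        exfalso; assert (l <= l - eps); [| generalize (cond_pos eps); lra].
        apply Hlub; intros r [a [b [Ha [Hab ->]]]].
        apply Rnot_lt_le; intros L; apply N; exists a, b; auto. }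
      destruct Happ as [a0 [b0 [Ha0 [Hab0 L]]]].
      apply (Filter_prod _ _ _ (fun a => 0 < a < a0) (fun b => b0 < b)).
      * unfold at_right, within; apply (filter_imp (fun t => t < a0));
          [intros t Ht Ht'; lra | apply open_lt, Ha0].
      * exists b0; auto.
      * intros a b Ha Hb; simpl; exists (RInt f a b); split.
        -- apply (RInt_correct f), Hex; lra.
        -- apply HP; unfold ball; simpl; unfold AbsRing_ball, abs, minus, plus, opp; simpl.
           assert (RInt f a b <= l)
             by (apply Hub; exists a, b; split; [lra | split; [lra | reflexivity]]).
           assert (A := Hsub a a0 b0 b); apply Rabs_def1; lra.
Qed.

(** [Gamma] is an [RInt_gen], about which nothing is known before convergence is shown. Positivity
    is enough for the density, since the value of the constant cancels. Arguments k + 1 with k > 0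
    are those that occur, and there the power is bounded near 0. *)
Lemma Gamma_pos k : 0 < k -> 0 < Gamma (k + 1).
Proof.
  intros Hk; unfold Gamma; replace (k + 1 - 1) with k by ring.
  set (f := fun t => Rpower t k * exp (- t)).
  set (K := exp (k * ln (2 * k) - k)).
  assert (HK : 0 < K) by apply exp_pos.
  destruct (is_RInt_gen_sup f (2 * K)) as [l [Hl HI]].
  - intros t Ht; apply Gamma_integrand_continuous, Ht.
  - intros t Ht; apply Rmult_lt_0_compat; apply exp_pos.
  - intros a b Ha Hab.
    assert (HI : is_RInt (fun t => K * exp (- (t / 2))) a b
       (- 2 * K * exp (- (b / 2)) - - 2 * K * exp (- (a / 2)))).
    { apply (is_RInt_derive (fun t => - 2 * K * exp (- (t / 2)))
        (fun t => K * exp (- (t / 2)))).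
      - intros x _; auto_derive; [exact I |]; unfold Rdiv; ring_simplify; field.
      - intros x _; apply (ex_derive_continuous (fun t => K * exp (- (t / 2))));
          auto_derive; exact I. }
    apply Rle_trans with (RInt (fun t => K * exp (- (t / 2))) a b).
    + apply RInt_le; [exact Hab | | eexists; exact HI |].
      * apply (ex_RInt_continuous f); intros z Hz; rewrite Rmin_left in Hz by lra.
        apply Gamma_integrand_continuous; lra.
      * intros t Ht; apply Rpower_exp_bound; lra.
    + rewrite (is_RInt_unique _ _ _ _ HI).
      assert (0 < exp (- (b / 2))) by apply exp_pos.
      assert (exp (- (a / 2)) < 1)
        by (rewrite <- exp_0; apply exp_increasing; lra).
      nra.
  - rewrite (is_RInt_gen_unique f l); [exact Hl | exact HI].
Qed.
(** * Concave pieces with increasing risk tolerance *)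

Definition risk_averse_on (A : R -> Prop) (V D S : R -> R) : Prop :=
  C2_on A V D S /\
  (forall x, A x -> 0 < D x /\ S x < 0) /\
  (forall x y, A x -> A y -> x < y -> D y / S y < D x / S x).

(** On the curve D/S = -q, so the ratio decreases in x because q increases in z and phi is
    increasing. *)
Lemma risk_averse_parametric_curve (phi q W : R -> R) a' a b b' :
  a' < a -> a <= b -> b < b' ->
  (forall z, a' <= z <= b' -> is_derive phi z (q z)) ->
  (forall z, a' <= z <= b' -> 0 < q z) ->
  (forall z, a' <= z <= b' -> continuous q z) ->
  (forall z, a' <= z <= b' -> is_derive W z (exp (- z) * q z)) ->
  increasing_on q a b ->
  exists V D S, risk_averse_on (fun x => phi a <= x <= phi b) V D S /\
    forall z, a <= z <= b ->
      V (phi z) = W z /\ D (phi z) = exp (- z) /\ S (phi z) = - (exp (- z) / q z).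
Proof.
  intros Ha Hab Hb Hphi Hq Hqc HW Hqi.
  destruct (C2_on_parametric_curve phi q W a' a b b') as [V [D [S [HC2 HE]]]];
    try assumption.
  exists V, D, S; split; [| exact HE].
  assert (Hi : increasing_on phi a b).
  { intros x y Hx Hxy Hy; apply (is_derive_pos_incr phi q); [exact Hxy | |];
      intros t Ht; [apply Hphi | apply Hq]; lra. }
  assert (Hsurj : forall x, phi a <= x <= phi b -> exists z, a <= z <= b /\ phi z = x).
  { intros x Hx; apply IVT_segment; [exact Hab | | exact Hx].
    intros t Ht; apply (is_derive_continuous phi t (q t)), Hphi; lra. }
  split; [exact HC2 | split].
  - intros x Hx; destruct (Hsurj x Hx) as [z [Hz <-]].
    destruct (HE z Hz) as [_ [-> ->]].
    assert (0 < exp (- z) / q z)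
      by (apply Rdiv_lt_0_compat; [apply exp_pos | apply Hq; lra]).
    split; [apply exp_pos | lra].
  - intros x y Hx Hy Hxy.
    destruct (Hsurj x Hx) as [z [Hz <-]], (Hsurj y Hy) as [t [Ht <-]].
    destruct (HE z Hz) as [_ [-> ->]], (HE t Ht) as [_ [-> ->]].
    assert (Hqz : 0 < q z) by (apply Hq; lra).
    assert (Hqt : 0 < q t) by (apply Hq; lra).
    assert (Ez := exp_pos (- z)); assert (Et := exp_pos (- t)).
    replace (exp (- t) / - (exp (- t) / q t)) with (- q t) by (field; lra).
    replace (exp (- z) / - (exp (- z) / q z)) with (- q z) by (field; lra).
    apply Ropp_lt_contravar, Hqi; [lra | | lra].
    destruct (Rtotal_order z t) as [L | [-> | L]]; [exact L | lra |].
    assert (B := Hi t z ltac:(lra) L ltac:(lra)); lra.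
Qed.

Lemma risk_averse_glue a c V1 D1 S1 V2 D2 S2 :
  a <= c -> V1 c = V2 c -> D1 c = D2 c -> S1 c = S2 c ->
  risk_averse_on (fun x => a <= x <= c) V1 D1 S1 ->
  risk_averse_on (fun x => c <= x) V2 D2 S2 ->
  risk_averse_on (fun x => a <= x) (glue c V1 V2) (glue c D1 D2) (glue c S1 S2).
Proof.
  intros Hac EV ED ES [C1 [P1 R1]] [C2 [P2 R2]].
  assert (L : forall x, x <= c -> glue c V1 V2 x = V1 x /\ glue c D1 D2 x = D1 x
                                  /\ glue c S1 S2 x = S1 x).
  { intros x Hx; rewrite !glue_left by exact Hx; auto. }
  assert (U : forall x, c <= x -> glue c V1 V2 x = V2 x /\ glue c D1 D2 x = D2 x
                                  /\ glue c S1 S2 x = S2 x).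
  { intros x Hx; rewrite !glue_right by assumption; auto. }
  split; [| split].
  - intros x Hx; apply (C2_on_glue c _ _ V1 D1 S1 V2 D2 S2 EV ED ES C1 C2); split; lra.
  - intros x Hx; destruct (Rle_dec x c).
    + destruct (L x) as [_ [-> ->]]; [assumption |]; apply P1; lra.
    + destruct (U x) as [_ [-> ->]]; [lra |]; apply P2; lra.
  - intros x y Hx Hy Hxy; destruct (Rle_dec y c).
    + destruct (L x) as [_ [-> ->]]; [lra |]; destruct (L y) as [_ [-> ->]]; [lra |].
      apply R1; lra.
    + destruct (U y) as [_ [-> ->]]; [lra |].
      destruct (Rle_dec c x).
      * destruct (U x) as [_ [-> ->]]; [lra |]; apply R2; lra.
      * destruct (L x) as [_ [-> ->]]; [lra |].
        apply Rlt_trans with (D2 c / S2 c); [apply R2; lra |].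
        rewrite <- ED, <- ES; apply R1; lra.
Qed.

(** * Dependence on the intensity gamma *)

Section Model.

Variables mu eta sigma delta : R.
Hypothesis Heta : 0 < eta.
Hypothesis Hsigma : 0 < sigma.
Hypothesis Hdelta : 0 < delta.
Hypothesis Hmu : eta < mu < 2 * eta.

Notation lam := (lambda eta sigma delta).
Notation alp := (alpha mu eta sigma delta).
Notation gam1 := (gamma1 mu eta sigma delta).

(** A negative root r makes sigma^2 r/2 + eta negative, since its product with r is delta + g > 0.
    The difference of the two equations then factors as r - r' times a negative number. The same
    factorisation gives [lambda_decreasing]. *)
Lemma lambda_root_unique g r r' :
  0 < delta + g ->
  r < 0 /\ sigma ^ 2 / 2 * r ^ 2 + eta * r - (delta + g) = 0 ->
  r' < 0 /\ sigma ^ 2 / 2 * r' ^ 2 + eta * r' - (delta + g) = 0 -> r = r'.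
Proof.
  intros Hg [Hr E] [Hr' E'].
  assert (A : sigma ^ 2 / 2 * r + eta < 0) by nra.
  assert (A' : sigma ^ 2 / 2 * r' + eta < 0) by nra.
  assert (F : (r - r') * (sigma ^ 2 / 2 * r + (sigma ^ 2 / 2 * r' + eta)) = 0) by lra.
  apply Rmult_integral in F; destruct F as [F | F]; [lra |].
  assert (0 < sigma ^ 2 / 2 * - r); [| lra].
  assert (0 < sigma ^ 2) by (apply pow_lt, Hsigma).
  apply Rmult_lt_0_compat; lra.
Qed.

Lemma lambda_eq g r :
  0 < delta + g ->
  r < 0 -> sigma ^ 2 / 2 * r ^ 2 + eta * r - (delta + g) = 0 -> lam g = r.
Proof.
  intros Hg Hr E; unfold lambda; apply (iota_unique (V := R_CompleteNormedModule)); [| auto].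
  intros y Hy; apply (lambda_root_unique g); auto.
Qed.

Lemma lambda_spec g :
  0 < delta + g ->
  lam g < 0 /\ sigma ^ 2 / 2 * lam g ^ 2 + eta * lam g - (delta + g) = 0.
Proof.
  intros Hg.
  set (s := sqrt (eta ^ 2 + 2 * sigma ^ 2 * (delta + g))).
  assert (Hs2 : 0 < sigma ^ 2) by (apply pow_lt, Hsigma).
  assert (Hs : s * s = eta ^ 2 + 2 * sigma ^ 2 * (delta + g)) by (apply sqrt_sqrt; nra).
  assert (Hs0 : 0 <= s) by apply sqrt_pos.
  set (r := - (eta + s) / sigma ^ 2).
  assert (Hr : r < 0).
  { apply Rmult_lt_reg_r with (sigma ^ 2); [exact Hs2 |].
    unfold r, Rdiv; rewrite Rmult_assoc, Rinv_l by lra; lra. }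
  assert (E : sigma ^ 2 / 2 * r ^ 2 + eta * r - (delta + g) = 0).
  { unfold r; replace (sigma ^ 2 / 2 * (- (eta + s) / sigma ^ 2) ^ 2
      + eta * (- (eta + s) / sigma ^ 2) - (delta + g))
      with ((s * s - (eta ^ 2 + 2 * sigma ^ 2 * (delta + g))) / (2 * sigma ^ 2))
      by (field; lra).
    rewrite Hs; field; lra. }
  rewrite (lambda_eq g r) by assumption; auto.
Qed.

Lemma lambda_decreasing g g' : 0 < delta + g -> g < g' -> lam g' < lam g.
Proof.
  intros Hg Hgg; destruct (lambda_spec g Hg) as [Hr E].
  destruct (lambda_spec g') as [Hr' E']; [lra |].
  apply Rnot_le_lt; intros L.
  assert (0 < sigma ^ 2) by (apply pow_lt, Hsigma).
  assert (A' : sigma ^ 2 / 2 * lam g' + eta < 0) by nra.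
  assert (F : (lam g' - lam g) * (sigma ^ 2 / 2 * lam g + (sigma ^ 2 / 2 * lam g' + eta))
              = g' - g) by lra.
  assert (0 < sigma ^ 2 / 2 * - lam g) by (apply Rmult_lt_0_compat; lra).
  nra.
Qed.

Lemma lambda_injective g g' : 0 < delta + g -> 0 < delta + g' -> lam g = lam g' -> g = g'.
Proof.
  intros Hg Hg' E; destruct (lambda_spec g Hg), (lambda_spec g' Hg').
  rewrite E in *; lra.
Qed.

(* At gamma1 one has alpha = 1, which is linear in lambda and hence solvable
   in closed form. *)
Lemma lambda_gamma1 : lam gam1 = - (2 * delta / mu + 2 * eta / sigma ^ 2).
Proof.
  assert (Hs2 : 0 < sigma ^ 2) by (apply pow_lt, Hsigma).
  set (l1 := - (2 * delta / mu + 2 * eta / sigma ^ 2)).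
  (* The value sigma^2 l1^2/2 + eta l1 - delta, that is, the intensity whose quadratic has the root
     [l1]; it is positive by mu < 2 eta. *)
  set (g1 := 2 * delta ^ 2 * sigma ^ 2 / mu ^ 2 + delta * (2 * eta - mu) / mu).
  assert (Hg1 : 0 < g1).
  { unfold g1; apply Rplus_lt_0_compat; apply Rdiv_lt_0_compat; try nra;
      repeat apply Rmult_lt_0_compat; try apply pow_lt; lra. }
  assert (Hl1 : l1 < 0).
  { assert (0 < 2 * delta / mu) by (apply Rdiv_lt_0_compat; lra).
    assert (0 < 2 * eta / sigma ^ 2) by (apply Rdiv_lt_0_compat; lra).
    unfold l1; lra. }
  assert (El : lam g1 = l1).
  { apply lambda_eq; [lra | exact Hl1 |]; unfold l1, g1; field; lra. }
  (* Eliminating r through the quadratic turns f1 minus its target into a nonzero multiple of lambda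
     - l1. Injectivity of lambda then gives uniqueness of [gamma1] without a monotonicity proof for
     [f1]. *)
  assert (Ef : forall r, 0 < r ->
    f1 eta sigma delta r - (2 * eta - mu) / (2 * delta)
    = mu * sigma ^ 2 * (lam r - l1) / (2 * delta * (sigma ^ 2 * lam r + 2 * eta))).
  { intros r Hr; destruct (lambda_spec r) as [Hl E]; [lra |].
    assert (Hne : sigma ^ 2 * lam r + 2 * eta < 0) by nra.
    unfold f1, l1.
    replace (delta + r) with (lam r * (sigma ^ 2 * lam r + 2 * eta) / 2) by lra.
    assert (Er : r = lam r * (sigma ^ 2 * lam r + 2 * eta) / 2 - delta) by lra.
    rewrite Er at 3; field; repeat split; lra. }
  assert (Eg : gam1 = g1); [| rewrite Eg; exact El].
  unfold gamma1; apply (iota_unique (V := R_CompleteNormedModule)).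
  - intros r [Hr E]; apply lambda_injective; [lra | lra |].
    rewrite El; specialize (Ef r Hr); rewrite E in Ef.
    destruct (lambda_spec r) as [Hl E']; [lra |].
    assert (Hne : sigma ^ 2 * lam r + 2 * eta < 0) by nra.
    assert (Ez : mu * sigma ^ 2 * (lam r - l1) = 0).
    { replace (mu * sigma ^ 2 * (lam r - l1)) with
        (mu * sigma ^ 2 * (lam r - l1) / (2 * delta * (sigma ^ 2 * lam r + 2 * eta))
         * (2 * delta * (sigma ^ 2 * lam r + 2 * eta))).
      - rewrite <- Ef; ring.
      - field; split; lra. }
    apply Rmult_integral in Ez; destruct Ez as [Ez | Ez]; [| lra].
    apply Rmult_integral in Ez; lra.
  - split; [exact Hg1 |]; specialize (Ef g1 Hg1); rewrite El in Ef.
    replace (mu * sigma ^ 2 * (l1 - l1) / (2 * delta * (sigma ^ 2 * l1 + 2 * eta)))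
      with 0 in Ef by (unfold Rdiv; ring).
    lra.
Qed.

(** Replacing (g + delta)/lambda by sigma^2 lambda/2 + eta makes the numerator affine in lambda. It
    therefore decreases with g and vanishes at [gamma1], which yields both alpha > 1 and the
    monotonicity of alpha below [gamma1]. *)
Lemma alpha_minus_1 g :
  0 < g -> alp g - 1 = (delta + mu * (lam g / 2 + eta / sigma ^ 2)) / g.
Proof.
  intros Hg; destruct (lambda_spec g) as [Hl E]; [lra |].
  assert (Hs2 : 0 < sigma ^ 2) by (apply pow_lt, Hsigma).
  unfold alpha.
  assert (E' : (g + delta) / lam g = sigma ^ 2 / 2 * lam g + eta).
  { replace (g + delta) with (sigma ^ 2 / 2 * lam g ^ 2 + eta * lam g) by lra.
    field; lra. }
  replace ((g + delta) / g * (1 + mu / (sigma ^ 2 * lam g)) - 1)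
    with ((delta + mu / sigma ^ 2 * ((g + delta) / lam g)) / g) by (field; lra).
  rewrite E'; field; lra.
Qed.

Lemma alpha_numerator_pos g :
  0 < g < gam1 -> 0 < delta + mu * (lam g / 2 + eta / sigma ^ 2).
Proof.
  intros Hg; assert (L := lambda_decreasing g gam1 ltac:(lra) ltac:(lra)).
  rewrite lambda_gamma1 in L.
  assert (Hs2 : 0 < sigma ^ 2) by (apply pow_lt, Hsigma).
  replace (delta + mu * (lam g / 2 + eta / sigma ^ 2))
    with (mu / 2 * (lam g - - (2 * delta / mu + 2 * eta / sigma ^ 2))) by (field; lra).
  apply Rmult_lt_0_compat; lra.
Qed.

Lemma alpha_gt_1 g : 0 < g < gam1 -> 1 < alp g.
Proof.
  intros Hg; assert (E := alpha_minus_1 g ltac:(lra)).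
  assert (0 < (delta + mu * (lam g / 2 + eta / sigma ^ 2)) / g)
    by (apply Rdiv_lt_0_compat; [apply alpha_numerator_pos, Hg | lra]).
  lra.
Qed.

Lemma alpha_decreasing g g' : 0 < g -> g < g' -> g' < gam1 -> alp g' < alp g.
Proof.
  intros Hg Hgg Hg'.
  assert (E := alpha_minus_1 g ltac:(lra)); assert (E' := alpha_minus_1 g' ltac:(lra)).
  assert (N' := alpha_numerator_pos g' ltac:(lra)).
  assert (L := lambda_decreasing g g' ltac:(lra) Hgg).
  set (n := delta + mu * (lam g / 2 + eta / sigma ^ 2)) in *.
  set (n' := delta + mu * (lam g' / 2 + eta / sigma ^ 2)) in *.
  assert (Hn : n' < n) by (unfold n, n'; nra).
  assert (n' / g' < n / g); [| lra].
  apply Rmult_lt_reg_r with (g * g'); [nra |].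
  replace (n' / g' * (g * g')) with (n' * g) by (field; lra).
  replace (n / g * (g * g')) with (n * g') by (field; lra).
  nra.
Qed.

(** * The risk tolerance as solution of the linear ODE *)

Notation eb := (etabar mu sigma).
Notation shape g := (eb * (delta + g)).
Notation cost := (eb * (mu - eta)).

Lemma etabar_pos : 0 < eb.
Proof.
  unfold etabar; apply Rdiv_lt_0_compat; [| apply pow_lt; lra].
  assert (0 < sigma ^ 2) by (apply pow_lt, Hsigma); lra.
Qed.

Lemma cost_pos : 0 < cost.
Proof. apply Rmult_lt_0_compat; [exact etabar_pos | lra]. Qed.

(** Equivalent to mu < 2 eta: the tolerance that v(0) = 0 imposes at zero surplus lies below the
    level at which u = 1. *)
Lemma cost_lt : cost < sigma ^ 2 / mu.
Proof.
  assert (Hs2 : 0 < sigma ^ 2) by (apply pow_lt, Hsigma).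
  assert (0 < sigma ^ 2 * (2 * eta - mu) / mu ^ 2)
    by (apply Rdiv_lt_0_compat; [apply Rmult_lt_0_compat; lra | apply pow_lt; lra]).
  replace (sigma ^ 2 / mu) with (cost + sigma ^ 2 * (2 * eta - mu) / mu ^ 2); [lra |].
  unfold etabar; field; lra.
Qed.

(* g(y) = g(1) / (y * weight y), so that no normalising constant is left. *)
Definition weight (g y : R) : R :=
  exp (eb * g * (y - 1) - (eb * (delta + g) + 1) * ln y).

(** Variation of constants: [weight] is the integrating factor of the ODE for q, and the first term
    imposes q = sigma^2/mu at alpha. *)
Definition weighted_tolerance (g z : R) : R :=
  sigma ^ 2 / mu * weight g (alp g) + cost * RInt (fun y => weight g y / y) z (alp g).

(* The risk tolerance -v'/v'' as a function of z = 1/v'. *)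
Definition tolerance (g z : R) : R := weighted_tolerance g z / weight g z.

Lemma weight_pos g y : 0 < weight g y.
Proof. apply exp_pos. Qed.

Lemma weight_1 g : weight g 1 = 1.
Proof.
  unfold weight; rewrite ln_1, <- exp_0; f_equal; ring.
Qed.

Lemma is_derive_weight g y :
  0 < y -> is_derive (weight g) y (weight g y * (eb * g - (shape g + 1) / y)).
Proof.
  intros Hy; unfold weight; auto_derive; [exact Hy |].
  unfold Rminus; field; lra.
Qed.

Lemma continuous_weight_div g y : 0 < y -> continuous (fun y => weight g y / y) y.
Proof.
  intros Hy; apply (ex_derive_continuous (fun y => weight g y / y)).
  unfold weight; auto_derive; split; [exact Hy |]; split; [lra | exact I].
Qed.

Lemma ex_RInt_weight_div g a b :
  0 < a -> 0 < b -> ex_RInt (fun y => weight g y / y) a b.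
Proof.
  intros Ha Hb; apply (ex_RInt_continuous (fun y => weight g y / y)).
  intros z Hz; apply continuous_weight_div.
  assert (0 < Rmin a b) by (apply Rmin_pos; assumption); lra.
Qed.

(** This is z q'(z) at z = alpha when q = sigma^2/mu there. By the definition of alpha, shape -
    etabar g alpha = -etabar (delta + g) mu / (sigma^2 lambda) > 0; what remains is sigma^2/mu -
    cost, positive by mu < 2 eta. *)
Lemma drift_at_alpha g :
  0 < g -> 0 < (shape g + 1 - eb * g * alp g) * (sigma ^ 2 / mu) - cost.
Proof.
  intros Hg; destruct (lambda_spec g) as [Hl _]; [lra |].
  assert (Hs2 : 0 < sigma ^ 2) by (apply pow_lt, Hsigma).
  assert (A1 : 0 < 2 * sigma ^ 2 * (g + delta) / (mu ^ 2 * - lam g)).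
  { apply Rdiv_lt_0_compat; apply Rmult_lt_0_compat; try apply pow_lt; lra. }
  assert (A2 : 0 < sigma ^ 2 * (2 * eta - mu) / mu ^ 2)
    by (apply Rdiv_lt_0_compat; [apply Rmult_lt_0_compat; lra | apply pow_lt; lra]).
  replace ((shape g + 1 - eb * g * alp g) * (sigma ^ 2 / mu) - cost)
    with (2 * sigma ^ 2 * (g + delta) / (mu ^ 2 * - lam g)
          + sigma ^ 2 * (2 * eta - mu) / mu ^ 2); [lra |].
  unfold etabar, alpha; field; lra.
Qed.

Section Tolerance.

Variable g : R.
Hypothesis Hg : 0 < g.
Hypothesis Halpha : 1 < alp g.

Lemma is_derive_weighted_tolerance z :
  0 < z -> is_derive (weighted_tolerance g) z (- (cost * (weight g z / z))).
Proof.
  intros Hz; unfold weighted_tolerance.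
  assert (HI : is_derive (fun z => RInt (fun y => weight g y / y) z (alp g)) z
                 (- (weight g z / z))).
  { apply (is_derive_RInt' (fun y => weight g y / y)
      (fun z => RInt (fun y => weight g y / y) z (alp g)) z (alp g)).
    - apply (filter_imp (fun t => 0 < t)); [| apply open_gt, Hz].
      intros t Ht; apply (RInt_correct (fun y => weight g y / y)).
      apply ex_RInt_weight_div; lra.
    - apply continuous_weight_div, Hz. }
  evar_last.
  - apply (is_derive_plus (fun _ => sigma ^ 2 / mu * weight g (alp g))).
    + apply is_derive_const.
    + apply (is_derive_scal _ _ cost _ HI).
  - unfold plus, zero; simpl; ring.
Qed.

Lemma weighted_tolerance_pos z : 0 < z <= alp g -> 0 < weighted_tolerance g z.
Proof.
  intros Hz; unfold weighted_tolerance.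
  assert (Hs2 : 0 < sigma ^ 2) by (apply pow_lt, Hsigma).
  assert (0 < sigma ^ 2 / mu * weight g (alp g)).
  { apply Rmult_lt_0_compat; [apply Rdiv_lt_0_compat; lra | apply weight_pos]. }
  assert (0 <= RInt (fun y => weight g y / y) z (alp g)).
  { apply RInt_ge_0; [lra | apply ex_RInt_weight_div; lra |].
    intros t Ht; left; apply Rdiv_lt_0_compat; [apply weight_pos | lra]. }
  assert (HcP := cost_pos); nra.
Qed.

Lemma tolerance_pos z : 0 < z <= alp g -> 0 < tolerance g z.
Proof.
  intros Hz; apply Rdiv_lt_0_compat;
    [apply weighted_tolerance_pos, Hz | apply weight_pos].
Qed.

Lemma tolerance_alpha : tolerance g (alp g) = sigma ^ 2 / mu.
Proof.
  unfold tolerance, weighted_tolerance; rewrite RInt_point.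
  assert (A := weight_pos g (alp g)); unfold zero; simpl; field; lra.
Qed.

(* The linear ODE z q'(z) = (1 + shape - eb g z) q(z) - cost satisfied by
   q = tolerance is the dual form of the HJB equation. *)
Lemma is_derive_tolerance z :
  0 < z -> is_derive (tolerance g) z
    (((1 + shape g - eb * g * z) * tolerance g z - cost) / z).
Proof.
  intros Hz; assert (A := weight_pos g z); evar_last.
  - apply (is_derive_div (weighted_tolerance g) (weight g));
      [apply is_derive_weighted_tolerance, Hz | apply is_derive_weight, Hz | lra].
  - unfold tolerance; field; lra.
Qed.

Lemma continuous_tolerance z : 0 < z -> continuous (tolerance g) z.
Proof. intros Hz; apply (is_derive_continuous _ _ _ (is_derive_tolerance z Hz)). Qed.

(* (weight z) z q'(z) has derivative - eb g weighted_tolerance < 0 and is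
   positive at alpha. *)
Lemma tolerance_slope_pos z :
  0 < z <= alp g -> 0 < (1 + shape g - eb * g * z) * tolerance g z - cost.
Proof.
  intros Hz.
  set (r := fun z => (1 + shape g - eb * g * z) * weighted_tolerance g z
                     - cost * weight g z).
  assert (Hr : forall t, 0 < t ->
    is_derive r t (- (eb * g * weighted_tolerance g t))).
  { intros t Ht; evar_last.
    - apply (is_derive_minus
        (fun z => (1 + shape g - eb * g * z) * weighted_tolerance g z)
        (fun z => cost * weight g z)).
      + apply (is_derive_mult (fun z => 1 + shape g - eb * g * z) (weighted_tolerance g) t
          (- (eb * g)) (- (cost * (weight g t / t)))).
        * auto_derive; [exact I | ring].
        * apply is_derive_weighted_tolerance, Ht.
        * intros; apply Rmult_comm.
      + apply (is_derive_scal (weight g)), is_derive_weight, Ht.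
    - unfold plus, minus, opp, mult; simpl; unfold plus, opp, mult; simpl; field; lra. }
  assert (E : forall t, r t = weight g t
                * ((1 + shape g - eb * g * t) * tolerance g t - cost)).
  { intros t; assert (A := weight_pos g t); unfold r, tolerance; field; lra. }
  assert (Ha : 0 < r (alp g)).
  { rewrite E, tolerance_alpha; apply Rmult_lt_0_compat; [apply weight_pos |].
    assert (B := drift_at_alpha g Hg); lra. }
  assert (Hz' : 0 < r z).
  { destruct (proj2 Hz) as [L | ->]; [| exact Ha].
    apply Rlt_trans with (r (alp g)); [exact Ha |].
    apply (is_derive_neg_decr r (fun t => - (eb * g * weighted_tolerance g t)));
      [exact L | intros t Ht; apply Hr; lra |].
    intros t Ht; assert (B := weighted_tolerance_pos t ltac:(lra)).
    assert (C := etabar_pos); assert (0 < eb * g * weighted_tolerance g t); [| lra].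
    apply Rmult_lt_0_compat; [apply Rmult_lt_0_compat |]; assumption. }
  rewrite E in Hz'; assert (A := weight_pos g z); nra.
Qed.

Lemma tolerance_increasing x y :
  0 < x -> x < y -> y <= alp g -> tolerance g x < tolerance g y.
Proof.
  intros Hx Hxy Hy; apply (is_derive_pos_incr (tolerance g)
    (fun z => ((1 + shape g - eb * g * z) * tolerance g z - cost) / z)); [exact Hxy | |].
  - intros t Ht; apply is_derive_tolerance; lra.
  - intros t Ht; apply Rdiv_lt_0_compat; [apply tolerance_slope_pos |]; lra.
Qed.

(** Gives the room beyond alpha that the curve needs for two-sided derivatives at ln alpha. *)
Lemma weighted_tolerance_pos_beyond_alpha :
  exists e, 0 < e /\ forall z, 0 < z <= alp g + e -> 0 < weighted_tolerance g z.
Proof.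
  assert (Hc : continuous (weighted_tolerance g) (alp g))
    by (apply (is_derive_continuous _ _ _ (is_derive_weighted_tolerance (alp g) ltac:(lra)))).
  assert (Hp : 0 < weighted_tolerance g (alp g)) by (apply weighted_tolerance_pos; lra).
  destruct (Hc (fun y => 0 < y) (open_gt 0 _ Hp)) as [[d Hd] HB].
  exists (d / 2); split; [lra |]; intros z Hz.
  destruct (Rle_dec z (alp g)); [apply weighted_tolerance_pos; lra |].
  apply HB; unfold ball; simpl; unfold AbsRing_ball, abs, minus, plus, opp; simpl.
  apply Rabs_def1; lra.
Qed.

(** As f4 is exp(etabar g) times the cost, f3 = f4 becomes the equation tolerance(1) = cost. *)
Lemma f3_eq : f3 mu eta sigma delta g = exp (eb * g) * tolerance g 1.
Proof.
  assert (Ew : forall y, 0 < y ->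
    exp (eb * g) * weight g y = exp (eb * g * y) / Rpower y (shape g + 1)).
  { intros y Hy; unfold weight, Rpower, Rdiv.
    rewrite <- exp_Ropp, <- !exp_plus; f_equal; ring. }
  unfold f3, tolerance; rewrite weight_1; unfold weighted_tolerance.
  assert (EI : exp (eb * g) * RInt (fun y => weight g y / y) 1 (alp g)
    = RInt (fun y => exp (eb * g * y) / Rpower y (eb * (delta + g) + 2)) 1 (alp g)).
  { transitivity (RInt (fun y => scal (exp (eb * g)) (weight g y / y)) 1 (alp g)).
    - symmetry; apply (RInt_scal (fun y => weight g y / y)), ex_RInt_weight_div; lra.
    - apply RInt_ext; intros y Hy; rewrite Rmin_left, Rmax_right in Hy by lra.
      replace (eb * (delta + g) + 2) with (shape g + 1 + 1) by ring.
      rewrite Rpower_plus, Rpower_1 by lra.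
      assert (E := Ew y ltac:(lra)); unfold scal; simpl; unfold mult; simpl.
      unfold Rdiv in *; rewrite <- Rmult_assoc, E, Rinv_mult; ring. }
  rewrite <- EI; assert (E := Ew (alp g) ltac:(lra)); simpl in E.
  assert (P0 : 0 < Rpower (alp g) (eb * (delta + g) + 1)) by apply exp_pos.
  replace (sigma ^ 2 * exp (eb * g * alp g) / (mu * Rpower (alp g) (eb * (delta + g) + 1)))
    with (sigma ^ 2 / mu * (exp (eb * g) * weight g (alp g)))
    by (rewrite E; field; lra).
  field; lra.
Qed.

End Tolerance.

(** The logarithm of [weight] is affine in g with slope etabar (y - 1 - ln y). *)
Lemma weight_increasing_shift g g' y : g < g' -> 1 < y -> weight g y < weight g' y.
Proof.
  intros Hgg Hy; apply exp_increasing.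
  assert (L : ln y < y - 1).
  { assert (A := exp_ineq1 (ln y)); rewrite exp_ln in A by lra.
    assert (0 < ln y) by (rewrite <- ln_1; apply ln_increasing; lra); lra. }
  assert (B := etabar_pos).
  assert (0 < eb * ((g' - g) * (y - 1 - ln y))); [| lra].
  apply Rmult_lt_0_compat; [exact B | apply Rmult_lt_0_compat; lra].
Qed.

(* The value at 1 increases through the weight; lowering the upper limit
   from alpha(g) to alpha(g') increases it as well, because the integral
   expression decreases in its upper limit up to alpha(g). *)
Lemma tolerance_1_increasing g g' :
  0 < g -> g < g' -> g' < gam1 -> tolerance g 1 < tolerance g' 1.
Proof.
  intros Hg Hgg Hg'.
  assert (Ha := alpha_gt_1 g ltac:(lra)); assert (Ha' := alpha_gt_1 g' ltac:(lra)).
  assert (Haa := alpha_decreasing g g' Hg Hgg Hg').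
  assert (Hs2 : 0 < sigma ^ 2 / mu)
    by (apply Rdiv_lt_0_compat; [apply pow_lt, Hsigma | lra]).
  assert (Hc := cost_pos).
  unfold tolerance; rewrite !weight_1, !Rdiv_1_r.
  set (phi := fun a => sigma ^ 2 / mu * weight g a
                       + cost * RInt (fun y => weight g y / y) 1 a).
  apply Rlt_trans with (phi (alp g')).
  - set (dphi := fun a => weight g a / a
      * (- ((shape g + 1 - eb * g * a) * (sigma ^ 2 / mu) - cost))).
    apply (is_derive_neg_decr phi dphi); [exact Haa | |].
    + intros t Ht.
      assert (HI : is_derive (fun a => RInt (fun y => weight g y / y) 1 a) t
                     (weight g t / t)).
      { apply (is_derive_RInt (fun y => weight g y / y)
          (fun a => RInt (fun y => weight g y / y) 1 a) 1 t).
        - apply (filter_imp (fun t => 0 < t)); [| apply open_gt; lra].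
          intros r Hr; apply (RInt_correct (fun y => weight g y / y)).
          apply ex_RInt_weight_div; lra.
        - apply continuous_weight_div; lra. }
      evar_last.
      * apply (is_derive_plus (fun a => sigma ^ 2 / mu * weight g a)
          (fun a => cost * RInt (fun y => weight g y / y) 1 a)).
        -- apply (is_derive_scal (weight g)), is_derive_weight; lra.
        -- apply (is_derive_scal _ _ cost _ HI).
      * unfold dphi, plus; simpl; field; lra.
    (* For t <= alpha(g) the bracket without its sign is at least its value at t = alpha(g), which
       is positive by [drift_at_alpha]. *)
    + intros t Ht; unfold dphi.
      assert (D0 := drift_at_alpha g Hg).
      assert (0 < weight g t / t) by (apply Rdiv_lt_0_compat; [apply weight_pos | lra]).
      assert (0 <= eb * g * (alp g - t)).
      { assert (B := etabar_pos).
        apply Rmult_le_pos; [apply Rmult_le_pos |]; lra. }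
      assert (0 <= eb * g * (alp g - t) * (sigma ^ 2 / mu)) by (apply Rmult_le_pos; lra).
      nra.
  - unfold phi, weighted_tolerance.
    apply Rplus_lt_le_compat.
    + apply Rmult_lt_compat_l; [exact Hs2 | apply weight_increasing_shift; assumption].
    + apply Rmult_le_compat_l; [lra |].
      apply RInt_le; [lra | apply ex_RInt_weight_div; lra | apply ex_RInt_weight_div; lra |].
      intros y Hy; apply Rmult_le_compat_r; [left; apply Rinv_0_lt_compat; lra |].
      left; apply weight_increasing_shift; lra.
Qed.

Lemma tolerance_1_gamma2 g2 :
  0 < g2 < gam1 -> f3 mu eta sigma delta g2 = f4 mu eta sigma g2 ->
  tolerance g2 1 = cost.
Proof.
  intros Hg2 E; rewrite f3_eq in E by (lra || apply alpha_gt_1, Hg2).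
  unfold f4 in E; assert (A := exp_pos (eb * g2)).
  apply (Rmult_eq_reg_l (exp (eb * g2))); lra.
Qed.

(** * The gamma density and the functions H, f-bar and f-hat in terms of the tolerance *)

Section Density.

Variable gamma : R.
Hypothesis Hgamma : 0 < gamma.
Hypothesis Halpha : 1 < alp gamma.

Notation den := (g mu sigma delta gamma).
Notation wt := (weight gamma).
Notation tol := (tolerance gamma).

Lemma shape_pos : 0 < shape gamma.
Proof. apply Rmult_lt_0_compat; [exact etabar_pos | lra]. Qed.

Lemma density_pos y : 0 < y -> 0 < den y.
Proof.
  intros Hy; unfold g; destruct (Rlt_dec 0 y); [| lra].
  repeat apply Rmult_lt_0_compat; try apply exp_pos.
  apply Rinv_0_lt_compat, Gamma_pos, shape_pos.
Qed.

Lemma density_eq y : 0 < y -> den y = den 1 / (y * wt y).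
Proof.
  intros Hy; unfold g, weight; destruct (Rlt_dec 0 y), (Rlt_dec 0 1); try lra.
  assert (HG := Gamma_pos (shape gamma) shape_pos).
  rewrite <- (exp_ln y) at 3 by exact Hy.
  rewrite <- exp_plus; unfold Rpower; rewrite ln_1.
  replace (exp (ln y + (eb * gamma * (y - 1) - (shape gamma + 1) * ln y)))
    with (/ (exp (shape gamma * ln y) * exp (- (gamma * eb * (y - 1)))))
    by (rewrite <- exp_plus, <- exp_Ropp; f_equal; ring).
  replace (exp (- (gamma * eb * y)))
    with (exp (- (gamma * eb * 1)) * exp (- (gamma * eb * (y - 1))))
    by (rewrite <- exp_plus; f_equal; ring).
  rewrite Rmult_0_r, exp_0.
  field; repeat split; try (apply Rgt_not_eq, exp_pos); lra.
Qed.

(** [G] integrates from 0, so the junction with the zero branch matters: near 0 the density is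
    dominated by K y^shape with positive shape. *)
Lemma continuous_density y : continuous den y.
Proof.
  destruct (Rtotal_order y 0) as [L | [-> | L]].
  - apply (continuous_ext_loc _ (fun _ => 0)); [| apply continuous_const].
    apply (filter_imp (fun t => t < 0)); [| apply open_lt, L].
    intros t Ht; unfold g; destruct (Rlt_dec 0 t); lra.
  - set (K := Rpower (eb * gamma) (shape gamma + 1) / Gamma (shape gamma + 1)).
    assert (HK : 0 < K).
    { apply Rdiv_lt_0_compat; [apply exp_pos | apply Gamma_pos, shape_pos]. }
    assert (Hk := shape_pos).
    apply filterlim_locally; intros eps.
    (* The solution of K d^shape = eps. *)
    set (d := Rpower (eps / K) (/ shape gamma)).
    exists (mkposreal d (exp_pos _)); intros t Ht.
    unfold ball in *; simpl in *; unfold AbsRing_ball, abs, minus, plus, opp in *; simpl in *.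
    unfold g; destruct (Rlt_dec 0 0); [lra |].
    destruct (Rlt_dec 0 t) as [P | P].
    + assert (Ht' : t < d) by (apply Rabs_def2 in Ht; lra).
      assert (A : K * Rpower t (shape gamma) < eps).
      { assert (B : Rpower t (shape gamma) < eps / K).
        { replace (eps / K) with (Rpower d (shape gamma)).
          - unfold Rpower; apply exp_increasing, Rmult_lt_compat_l; [exact Hk |].
            apply ln_increasing; assumption.
          - unfold d; rewrite Rpower_mult, Rinv_l, Rpower_1 by
              (lra || (apply Rdiv_lt_0_compat; [apply cond_pos | exact HK])).
            reflexivity. }
        apply (Rmult_lt_compat_l K) in B; [| exact HK].
        replace (K * (eps / K)) with (pos eps) in B by (field; lra); exact B. }
      assert (A0 : 0 < K * Rpower t (shape gamma))
        by (apply Rmult_lt_0_compat; [exact HK | apply exp_pos]).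
      assert (E1 : exp (- (gamma * eb * t)) < 1).
      { rewrite <- exp_0; apply exp_increasing.
        assert (0 < gamma * eb * t); [| lra].
        apply Rmult_lt_0_compat; [| exact P].
        apply Rmult_lt_0_compat; [exact Hgamma | exact etabar_pos]. }
      assert (E0 := exp_pos (- (gamma * eb * t))).
      fold K; apply Rabs_def1; nra.
    + rewrite Ropp_0, Rplus_0_r, Rabs_R0; apply cond_pos.
  - apply (continuous_ext_loc _ (fun y => den 1 / (y * wt y))).
    + apply (filter_imp (fun t => 0 < t)); [| apply open_gt, L].
      intros t Ht; symmetry; apply density_eq, Ht.
    + apply (ex_derive_continuous (fun y => den 1 / (y * wt y))).
      unfold weight; auto_derive; split; [exact L |]; split; [| exact I].
      apply Rgt_not_eq, Rmult_lt_0_compat; [exact L | apply exp_pos].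
Qed.

Lemma is_derive_G z : is_derive (G mu sigma delta gamma) z (den z).
Proof.
  apply (is_derive_RInt den (G mu sigma delta gamma) 0 z); [| apply continuous_density].
  apply filter_forall; intros t; apply (RInt_correct den), (ex_RInt_continuous den).
  intros y _; apply continuous_density.
Qed.

Lemma H_integrand y : 0 < y -> 1 / (y ^ 2 * den y) = / den 1 * (wt y / y).
Proof.
  intros Hy; rewrite (density_eq y Hy).
  assert (A := density_pos 1 Rlt_0_1); assert (B := weight_pos gamma y).
  field; lra.
Qed.

Lemma H_eq beta z :
  0 < z -> H mu sigma delta gamma beta z
           = / den 1 * RInt (fun y => wt y / y) (exp (- beta)) z.
Proof.
  intros Hz; assert (Hm := exp_pos (- beta)); unfold H.
  transitivity (RInt (fun y => scal (/ den 1) (wt y / y)) (exp (- beta)) z).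
  - apply RInt_ext; intros y Hy; apply H_integrand.
    assert (0 < Rmin (exp (- beta)) z) by (apply Rmin_pos; assumption); lra.
  - apply (RInt_scal (fun y => wt y / y)), ex_RInt_weight_div; assumption.
Qed.

Lemma is_derive_H beta z :
  0 < z -> is_derive (H mu sigma delta gamma beta) z (1 / (z ^ 2 * den z)).
Proof.
  intros Hz; assert (Hm := exp_pos (- beta)).
  rewrite H_integrand by exact Hz.
  apply (is_derive_ext_loc
    (fun z => / den 1 * RInt (fun y => wt y / y) (exp (- beta)) z)).
  - apply (filter_imp (fun t => 0 < t)); [| apply open_gt, Hz].
    intros t Ht; symmetry; apply H_eq, Ht.
  - apply is_derive_scal.
    apply (is_derive_RInt (fun y => wt y / y) _ (exp (- beta)) z).
    + apply (filter_imp (fun t => 0 < t)); [| apply open_gt, Hz].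
      intros t Ht; apply (RInt_correct (fun y => wt y / y)).
      apply ex_RInt_weight_div; assumption.
    + apply continuous_weight_div, Hz.
Qed.

Notation c31' := (c31 mu eta sigma delta gamma).
Notation c33' := (c33 mu eta sigma delta gamma).
Notation fbar' := (fbar mu eta sigma delta gamma).
Notation fhat' := (fhat mu eta sigma delta gamma).

(** The integral up to alpha inside [c31] minus the one up to z leaves the integral from z to alpha.
    The base point exp(-beta) disappears, so one tolerance function serves every beta. *)
Lemma c31_minus_H beta z :
  0 < z -> c31' beta - cost * H mu sigma delta gamma beta z
           = weighted_tolerance gamma z / den 1.
Proof.
  intros Hz; unfold c31, weighted_tolerance.
  rewrite !H_eq, (density_eq (alp gamma)) by lra.
  assert (C : RInt (fun y => wt y / y) (exp (- beta)) z
      + RInt (fun y => wt y / y) z (alp gamma)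
      = RInt (fun y => wt y / y) (exp (- beta)) (alp gamma)).
  { assert (Hm := exp_pos (- beta)).
    apply (RInt_Chasles (fun y => wt y / y)); apply ex_RInt_weight_div; lra. }
  rewrite <- C.
  assert (A := density_pos 1 Rlt_0_1); assert (B := weight_pos gamma (alp gamma)).
  field; lra.
Qed.

Lemma density_c31_minus_H beta z :
  0 < z -> den z * z * (c31' beta - cost * H mu sigma delta gamma beta z) = tol z.
Proof.
  intros Hz; rewrite c31_minus_H, density_eq by exact Hz; unfold tolerance.
  assert (A := density_pos 1 Rlt_0_1); assert (B := weight_pos gamma z).
  field; lra.
Qed.

(** G times the derivative of H cancels the integrand of the last integral. What remains is g (c31 -
    cost H), which is q/z, the required dx/dz. *)
Lemma is_derive_fbar beta z : 0 < z -> is_derive (fbar' beta) z (tol z / z).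
Proof.
  intros Hz; assert (Hm := exp_pos (- beta)).
  set (GG := G mu sigma delta gamma); set (HH := H mu sigma delta gamma beta).
  set (q := fun y => GG y / (y ^ 2 * den y)).
  assert (HI : is_derive (fun z => RInt q (exp (- beta)) z) z (q z)).
  { assert (Hq : forall t, 0 < t -> continuous q t).
    { intros t Ht; apply (continuous_mult GG (fun y => / (y ^ 2 * den y))).
      - apply (is_derive_continuous _ _ _ (is_derive_G t)).
      - apply continuity_pt_filterlim, continuity_pt_inv.
        + apply continuity_pt_filterlim.
          apply (continuous_mult (fun y => y ^ 2) den); [| apply continuous_density].
          apply (ex_derive_continuous (fun y => y ^ 2)); auto_derive; exact I.
        + apply Rgt_not_eq, Rmult_lt_0_compat; [apply pow_lt, Ht | apply density_pos, Ht]. }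
    apply (is_derive_RInt q _ (exp (- beta)) z); [| apply Hq, Hz].
    apply (filter_imp (fun t => 0 < t)); [| apply open_gt, Hz].
    intros t Ht; apply (RInt_correct q), (ex_RInt_continuous q).
    intros r Hr; apply Hq.
    assert (0 < Rmin (exp (- beta)) t) by (apply Rmin_pos; assumption); lra. }
  rewrite <- (density_c31_minus_H beta z Hz).
  unfold fbar; fold GG HH q.
  evar_last.
  - apply (is_derive_minus (fun z => c31' beta * (GG z - GG (exp (- beta))))
      (fun z => cost * (GG z * HH z - RInt q (exp (- beta)) z))).
    + apply (is_derive_scal (fun z => GG z - GG (exp (- beta)))).
      apply (is_derive_minus GG (fun _ => GG (exp (- beta)))); [apply is_derive_G |].
      apply is_derive_const.
    + apply (is_derive_scal (fun z => GG z * HH z - RInt q (exp (- beta)) z)).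
      apply (is_derive_minus (fun z => GG z * HH z) (fun z => RInt q (exp (- beta)) z));
        [| exact HI].
      apply (is_derive_mult GG HH); [apply is_derive_G | apply is_derive_H, Hz |].
      intros; apply Rmult_comm.
  - unfold q, plus, minus, opp, mult, zero; simpl; unfold plus, opp, mult; simpl.
    assert (A := density_pos z Hz); field; lra.
Qed.

Lemma fbar_start beta : fbar' beta (exp (- beta)) = 0.
Proof.
  unfold fbar, H; rewrite !RInt_point; unfold zero; simpl; ring.
Qed.

Lemma is_derive_fbar_exp beta z :
  is_derive (fun z => fbar' beta (exp z)) z (tol (exp z)).
Proof.
  assert (Hz := exp_pos z); evar_last.
  - apply (is_derive_comp (fbar' beta) exp);
      [apply is_derive_fbar, Hz | apply is_derive_exp].
  - unfold scal; simpl; unfold mult; simpl; field; lra.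
Qed.

(** Both sides are multiples of 1/(g(1) etabar), by mu/2 = sigma^2/(mu etabar); after clearing this
    factor the equation is the boundary value of q at zero surplus. *)
Lemma Mhat_equation_iff M :
  Mhat_equation mu eta sigma delta gamma M <-> tol (exp M) = cost.
Proof.
  assert (HM := exp_pos M).
  assert (A := density_pos 1 Rlt_0_1); assert (B := weight_pos gamma (exp M)).
  assert (Bal := weight_pos gamma (alp gamma)); assert (He := etabar_pos).
  unfold Mhat_equation; rewrite H_eq, (density_eq (exp M)), (density_eq (alp gamma)) by lra.
  unfold tolerance, weighted_tolerance.
  replace (- - M) with M by ring.
  set (I := RInt (fun y => wt y / y) (exp M) (alp gamma)).
  replace (mu / (2 * alp gamma * (den 1 / (alp gamma * wt (alp gamma)))))
    with (sigma ^ 2 / mu * wt (alp gamma) / (den 1 * eb))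
    by (unfold etabar; field; repeat split; lra).
  replace ((mu - eta) / (exp M * (den 1 / (exp M * wt (exp M)))))
    with (cost * wt (exp M) / (den 1 * eb)) by (field; repeat split; lra).
  replace ((mu - eta) * (/ den 1 * I)) with (cost * I / (den 1 * eb))
    by (field; repeat split; lra).
  assert (Hp : 0 < den 1 * eb) by (apply Rmult_lt_0_compat; assumption).
  split; intros E.
  - apply (Rmult_eq_reg_r (wt (exp M))); [| lra].
    unfold Rdiv at 1; rewrite Rmult_assoc, Rinv_l, Rmult_1_r by lra.
    apply (Rmult_eq_reg_r (/ (den 1 * eb))); [| apply Rinv_neq_0_compat; lra].
    unfold Rdiv in E |- *; rewrite E; ring.
  - set (num := sigma ^ 2 / mu * wt (alp gamma) + cost * I) in E.
    assert (E' : num = cost * wt (exp M)).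
    { transitivity (num / wt (exp M) * wt (exp M)); [field; lra | rewrite E; ring]. }
    unfold Rdiv at 1; rewrite <- E'; unfold num; field; repeat split; lra.
Qed.

(** At z = exp M the integral H is empty, so g(z) z c31 is the tolerance there, hence the cost, and
    this is the definition of [c33]. The hat formulas thus become bar formulas with another base
    point. *)
Lemma c33_eq_c31 M :
  tol (exp M) = cost -> c33' (- M) = c31' (- M).
Proof.
  intros E; assert (A := density_c31_minus_H (- M) (exp M) (exp_pos M)).
  rewrite E in A; unfold c33.
  assert (EH : H mu sigma delta gamma (- M) (exp M) = 0).
  { unfold H; replace (- - M) with M by ring; rewrite RInt_point; reflexivity. }
  rewrite EH in A; replace (- - M) with M by ring; rewrite <- A at 1.
  assert (B := density_pos (exp M) (exp_pos M)); assert (C := exp_pos M).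
  field; lra.
Qed.

Lemma fhat_eq_fbar M z :
  tol (exp M) = cost -> fhat' (- M) z = fbar' (- M) z.
Proof. intros E; unfold fhat; rewrite (c33_eq_c31 M E); reflexivity. Qed.

End Density.

(** * Gluing the regions *)

Section UpperRegion.

(** The data that differ between the cases: ([zlo], [b], [vb]) is (0, b2, v(b2)) when a region
    without lump payments lies below, and (M, 0, 0) otherwise. [zlo] is the value of -ln v' at b. *)
Variables gamma zlo b vb : R.
Variable psi : R -> R.
Hypothesis Hgamma : 0 < gamma.
Hypothesis Halpha : 1 < alp gamma.
Hypothesis Hzlo : zlo < ln (alp gamma).
Hypothesis Hpsi : forall z, is_derive psi z (tolerance gamma (exp z)).
Hypothesis Hpsi0 : psi zlo = 0.

Notation tol := (tolerance gamma).
Notation X := (psi (ln (alp gamma)) + b).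

(** The optimised HJB equation solved for v, with v' = exp(-z), -v'/v'' = q and v(b) + x - b = vb +
    psi z. *)
Definition curve_value (z : R) : R :=
  exp (- z) / (delta + gamma) * (tol (exp z) / eb - (mu - eta))
  + gamma * (vb + psi z) / (delta + gamma).

(** For u = 1 the equation is linear with constant coefficients: an affine particular solution plus
    the decaying exponential. *)
Definition tail_value (x : R) : R :=
  c32 mu eta sigma delta gamma (alp gamma) * exp (lam gamma * (x - X))
  + gamma / (gamma + delta) * (x - b + vb + eta / (delta + gamma)).

Definition tail_slope (x : R) : R :=
  lam gamma * c32 mu eta sigma delta gamma (alp gamma) * exp (lam gamma * (x - X))
  + gamma / (gamma + delta).

Definition tail_curvature (x : R) : R :=
  lam gamma ^ 2 * c32 mu eta sigma delta gamma (alp gamma) * exp (lam gamma * (x - X)).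

(** The ODE for q is used here: it makes the derivative of the value equal to v' dx/dz, so that the
    curve is the graph of a function with slope exp(-z). *)
Lemma is_derive_curve_value z :
  is_derive curve_value z (exp (- z) * tol (exp z)).
Proof.
  assert (He := exp_pos z); assert (Heb := etabar_pos).
  assert (Ht : is_derive (fun z => tol (exp z)) z
    ((1 + shape gamma - eb * gamma * exp z) * tol (exp z) - cost)).
  { evar_last.
    - apply (is_derive_comp tol exp);
        [apply is_derive_tolerance; assumption | apply is_derive_exp].
    - unfold scal; simpl; unfold mult; simpl; field; lra. }
  evar_last.
  - apply (is_derive_plus
      (fun z => exp (- z) / (delta + gamma) * (tol (exp z) / eb - (mu - eta)))
      (fun z => gamma * (vb + psi z) / (delta + gamma))).
    + apply (is_derive_mult (fun z => exp (- z) / (delta + gamma))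
        (fun z => tol (exp z) / eb - (mu - eta)) z (- exp (- z) / (delta + gamma))
        (((1 + shape gamma - eb * gamma * exp z) * tol (exp z) - cost) / eb));
        [| | intros; apply Rmult_comm].
      * auto_derive; [lra |]; field; lra.
      * evar_last.
        -- apply (is_derive_minus (fun z => tol (exp z) / eb) (fun _ => mu - eta));
             [| apply is_derive_const].
           apply (is_derive_ext (fun z => / eb * tol (exp z)));
             [intros t; unfold Rdiv; apply Rmult_comm |].
           apply (is_derive_scal _ _ (/ eb) _ Ht).
        -- unfold minus, plus, opp, zero; simpl; field; lra.
    + apply (is_derive_ext (fun z => gamma / (delta + gamma) * (vb + psi z)));
        [intros t; match goal with |- @eq _ ?x ?y => change (@eq R x y) end; field; lra |].
      apply (is_derive_scal (fun z => vb + psi z)).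
      apply (is_derive_plus (fun _ => vb) psi); [apply is_derive_const | apply Hpsi].
  - assert (E1 : exp (- z) * exp z = 1) by (rewrite <- exp_plus, Rplus_opp_l; apply exp_0).
    unfold plus, mult, zero; simpl; unfold plus, mult; simpl.
    apply (Rmult_eq_reg_r (delta + gamma)); [| lra].
    (* [field] treats exp(-z) and exp z as unrelated, so the surplus is isolated in a multiple of 1
       - exp(-z) exp z. *)
    transitivity (exp (- z) * tol (exp z) * (delta + gamma)
      + gamma * tol (exp z) * (1 - exp (- z) * exp z)); [| rewrite E1; ring].
    field; lra.
Qed.

Lemma is_derive_tail_value x : is_derive tail_value x (tail_slope x).
Proof.
  unfold tail_value, tail_slope; auto_derive; [exact I |]; unfold Rminus; ring.
Qed.

Lemma is_derive_tail_slope x : is_derive tail_slope x (tail_curvature x).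
Proof.
  unfold tail_curvature, tail_slope; auto_derive; [exact I |]; unfold Rminus; ring.
Qed.

Lemma c32_neg : c32 mu eta sigma delta gamma (alp gamma) < 0.
Proof.
  destruct (lambda_spec gamma ltac:(lra)) as [Hl _].
  unfold c32; apply Ropp_lt_gt_0_contravar, Rdiv_lt_0_compat; [lra |].
  apply Rmult_lt_0_compat; [apply Rmult_lt_0_compat; [apply pow_lt |] |]; nra.
Qed.

(** The ratio of slope to curvature is 1/lambda - k/e with k > 0 and e the decaying exponential. *)
Lemma tail_risk_averse :
  risk_averse_on (fun x => X <= x) tail_value tail_slope tail_curvature.
Proof.
  destruct (lambda_spec gamma ltac:(lra)) as [Hl _]; assert (Hc := c32_neg).
  assert (Hl2 : 0 < lam gamma ^ 2) by nra.
  assert (Hr : 0 < gamma / (gamma + delta)) by (apply Rdiv_lt_0_compat; lra).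
  split; [| split].
  - intros x _; split; [apply is_derive_tail_value |].
    split; [apply is_derive_tail_slope |].
    apply (ex_derive_continuous tail_curvature); unfold tail_curvature.
    auto_derive; exact I.
  - intros x _; assert (He := exp_pos (lam gamma * (x - X))).
    unfold tail_slope, tail_curvature; split.
    + assert (0 < lam gamma * c32 mu eta sigma delta gamma (alp gamma)) by nra; nra.
    + assert (lam gamma ^ 2 * c32 mu eta sigma delta gamma (alp gamma) < 0) by nra; nra.
  - intros x y _ _ Hxy; unfold tail_slope, tail_curvature.
    assert (He := exp_pos (lam gamma * (x - X))).
    assert (He' := exp_pos (lam gamma * (y - X))).
    assert (Hee : exp (lam gamma * (y - X)) < exp (lam gamma * (x - X)))
      by (apply exp_increasing; nra).
    assert (Hinv := Rinv_lt_contravar _ _ (Rmult_lt_0_compat _ _ He' He) Hee).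
    set (e := exp (lam gamma * (x - X))) in *; set (e' := exp (lam gamma * (y - X))) in *.
    set (c := c32 mu eta sigma delta gamma (alp gamma)) in *.
    assert (Hk : 0 < gamma / (gamma + delta) / (lam gamma ^ 2 * - c))
      by (apply Rdiv_lt_0_compat; [exact Hr | nra]).
    replace ((lam gamma * c * e + gamma / (gamma + delta)) / (lam gamma ^ 2 * c * e))
      with (/ lam gamma - gamma / (gamma + delta) / (lam gamma ^ 2 * - c) * / e)
      by (field; repeat split; lra).
    replace ((lam gamma * c * e' + gamma / (gamma + delta)) / (lam gamma ^ 2 * c * e'))
      with (/ lam gamma - gamma / (gamma + delta) / (lam gamma ^ 2 * - c) * / e')
      by (field; repeat split; lra).
    nra.
Qed.

(* Smooth fit at X, where z = ln alpha: the choice of alpha matches v' and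
   the choice of c32 matches v''. *)
Lemma tail_smooth_fit :
  tail_value X = curve_value (ln (alp gamma)) /\
  tail_slope X = exp (- ln (alp gamma)) /\
  tail_curvature X = - (exp (- ln (alp gamma)) / tol (exp (ln (alp gamma)))).
Proof.
  destruct (lambda_spec gamma ltac:(lra)) as [Hl El].
  assert (Hal : 1 + mu / (sigma ^ 2 * lam gamma) = alp gamma * (gamma / (gamma + delta))).
  { unfold alpha; field; repeat split; lra. }
  assert (Hs2 : 0 < sigma ^ 2) by (apply pow_lt, Hsigma).
  unfold tail_value, tail_slope, tail_curvature, curve_value, c32.
  rewrite exp_Ropp, exp_ln, tolerance_alpha by lra.
  replace (lam gamma * (X - X)) with 0 by ring; rewrite exp_0.
  set (a := alp gamma) in *; set (l := lam gamma) in *.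
  assert (Hrat : gamma / (gamma + delta) = (1 + mu / (sigma ^ 2 * l)) / a)
    by (rewrite Hal; field; lra).
  split; [| split].
  (* No constant is left to adjust the values; they agree once the quadratic of lambda eliminates
     gamma + delta. *)
  - assert (Eg : gamma + delta = l * (sigma ^ 2 * l + 2 * eta) / 2) by lra.
    assert (Hne : sigma ^ 2 * l + 2 * eta < 0) by nra.
    replace (gamma * (vb + psi (ln a)) / (delta + gamma))
      with (gamma / (gamma + delta) * (vb + psi (ln a))) by (field; lra).
    replace (psi (ln a) + b - b + vb + eta / (delta + gamma))
      with (vb + psi (ln a) + eta / (delta + gamma)) by ring.
    rewrite Rmult_plus_distr_l, Hrat, (Rplus_comm delta gamma), Eg.
    unfold etabar; field; repeat split; lra.
  - rewrite Hrat; field; repeat split; lra.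
  - field; repeat split; lra.
Qed.

Lemma curve_ode z :
  - (mu ^ 2 / (2 * sigma ^ 2)) * (exp (- z) ^ 2 / - (exp (- z) / tol (exp z)))
  - (mu - eta) * exp (- z) - delta * curve_value z
  + gamma * (vb + psi z - curve_value z) = 0.
Proof.
  assert (He := exp_pos (- z)).
  replace (exp (- z) ^ 2 / - (exp (- z) / tol (exp z)))
    with (- (exp (- z) * tol (exp z)))
    by (unfold Rdiv; rewrite Rinv_opp, Rinv_mult, Rinv_inv; field; lra).
  unfold curve_value, etabar; field; lra.
Qed.

Lemma tail_ode x :
  / 2 * sigma ^ 2 * tail_curvature x + eta * tail_slope x - delta * tail_value x
  + gamma * (x - b + vb - tail_value x) = 0.
Proof.
  destruct (lambda_spec gamma ltac:(lra)) as [_ El].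
  unfold tail_value, tail_slope, tail_curvature.
  set (c := c32 mu eta sigma delta gamma (alp gamma)).
  set (e := exp (lam gamma * (x - X))).
  transitivity (c * e * (sigma ^ 2 / 2 * lam gamma ^ 2 + eta * lam gamma - (delta + gamma)));
    [field; lra | rewrite El; ring].
Qed.

Lemma upper_solution :
  exists V D S,
    risk_averse_on (fun x => b <= x) V D S /\
    (forall z, zlo <= z <= ln (alp gamma) ->
       V (psi z + b) = curve_value z /\ D (psi z + b) = exp (- z) /\
       S (psi z + b) = - (exp (- z) / tol (exp z))) /\
    (forall x, X <= x -> V x = tail_value x) /\
    D X / S X = - (sigma ^ 2 / mu) /\
    (forall x, b <= x <= X ->
       - (mu ^ 2 / (2 * sigma ^ 2)) * (D x ^ 2 / S x) - (mu - eta) * D x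
       - delta * V x + gamma * (x - b + vb - V x) = 0) /\
    (forall x, X <= x ->
       / 2 * sigma ^ 2 * S x + eta * D x - delta * V x + gamma * (x - b + vb - V x) = 0).
Proof.
  assert (Hs2 : 0 < sigma ^ 2) by (apply pow_lt, Hsigma).
  destruct (weighted_tolerance_pos_beyond_alpha gamma Halpha) as [e [He Hwt]].
  set (top := ln (alp gamma + e)).
  assert (Htop : ln (alp gamma) < top) by (apply ln_increasing; lra).
  assert (Hexp : forall z, z <= top -> 0 < exp z <= alp gamma + e).
  { intros z Hz; split; [apply exp_pos |].
    rewrite <- (exp_ln (alp gamma + e)) by lra.
    destruct Hz as [L | ->]; [left; apply exp_increasing, L | right; reflexivity]. }
  assert (Hexp' : forall z, z <= ln (alp gamma) -> exp z <= alp gamma).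
  { intros z Hz; rewrite <- (exp_ln (alp gamma)) by lra.
    destruct Hz as [L | ->]; [left; apply exp_increasing, L | right; reflexivity]. }
  (* Below [zlo] any margin works, as the weighted tolerance is positive on all of (0, alpha]; above
     ln alpha only the small margin up to [top] is available. *)
  destruct (risk_averse_parametric_curve (fun z => psi z + b) (fun z => tol (exp z))
    curve_value (zlo - 1) zlo (ln (alp gamma)) top) as [V [D [S [HR HE]]]]; try lra.
  - intros z _; evar_last.
    + apply (is_derive_plus psi (fun _ => b)); [apply Hpsi | apply is_derive_const].
    + unfold plus, zero; simpl; ring.
  - intros z Hz; apply Rdiv_lt_0_compat; [apply Hwt, Hexp; lra | apply weight_pos].
  - intros z _; apply (continuous_comp exp tol);
      [apply (is_derive_continuous _ _ _ (is_derive_exp z)) |].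
    apply continuous_tolerance; [assumption .. | apply exp_pos].
  - intros z _; apply is_derive_curve_value.
  - intros x y Hx Hxy Hy; apply tolerance_increasing; try assumption.
    + apply exp_pos.
    + apply exp_increasing, Hxy.
    + apply Hexp', Hy.
  - rewrite Hpsi0, Rplus_0_l in HR.
    assert (HbX : b < X).
    { assert (psi zlo < psi (ln (alp gamma))); [| lra].
      apply (is_derive_pos_incr psi (fun z => tol (exp z))); [exact Hzlo | |].
      - intros t _; apply Hpsi.
      - intros t Ht; apply Rdiv_lt_0_compat; [apply Hwt, Hexp; lra | apply weight_pos]. }
    destruct tail_smooth_fit as [F1 [F2 F3]].
    destruct (HE (ln (alp gamma))) as [E1 [E2 E3]]; [lra |].
    exists (glue X V tail_value), (glue X D tail_slope), (glue X S tail_curvature).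
    rewrite <- F1 in E1; rewrite <- F2 in E2; rewrite <- F3 in E3.
    assert (Hsurj : forall x, b <= x <= X ->
      exists z, zlo <= z <= ln (alp gamma) /\ psi z + b = x).
    { intros x Hx; apply (IVT_segment (fun z => psi z + b)); [lra | |].
      - intros t _; apply (continuous_plus psi); [| apply continuous_const].
        apply (is_derive_continuous _ _ _ (Hpsi t)).
      - rewrite Hpsi0; lra. }
    assert (Hle : forall z, zlo <= z <= ln (alp gamma) -> psi z + b <= X).
    { intros z [Hz [L | ->]]; [| lra].
      assert (psi z < psi (ln (alp gamma))); [| lra].
      apply (is_derive_pos_incr psi (fun z => tol (exp z))); [exact L | |].
      - intros t _; apply Hpsi.
      - intros t Ht; apply Rdiv_lt_0_compat; [apply Hwt, Hexp; lra | apply weight_pos]. }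
    split; [| split; [| split; [| split; [| split]]]].
    + apply risk_averse_glue; [lra | assumption .. | exact tail_risk_averse].
    + intros z Hz; rewrite !glue_left by (apply Hle, Hz); apply HE, Hz.
    + intros x Hx; apply glue_right; assumption.
    + rewrite !glue_right, F2, F3 by (assumption || lra).
      rewrite exp_ln, tolerance_alpha by lra.
      assert (A := exp_pos (- ln (alp gamma))); field; repeat split; lra.
    + intros x Hx; rewrite !glue_left by lra.
      destruct (Hsurj x Hx) as [z [Hz <-]]; destruct (HE z Hz) as [-> [-> ->]].
      replace (psi z + b - b + vb) with (vb + psi z) by ring; apply curve_ode.
    + intros x Hx; rewrite !glue_right by assumption; apply tail_ode.
Qed.

End UpperRegion.

Lemma C2_on_continuous A V D S x : C2_on A V D S -> A x -> continuous V x.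
Proof. intros HC Hx; apply (is_derive_continuous V x (D x)), HC, Hx. Qed.

Lemma exp_le_alpha g z : 0 < alp g -> z <= ln (alp g) -> exp z <= alp g.
Proof.
  intros Ha [L | ->]; [| right; apply exp_ln, Ha].
  left; rewrite <- (exp_ln (alp g)) by exact Ha; apply exp_increasing, L.
Qed.

Lemma tolerance_exp_pos g z :
  1 < alp g -> z <= ln (alp g) -> 0 < tolerance g (exp z).
Proof.
  intros Ha Hz; apply tolerance_pos; [exact Ha |].
  split; [apply exp_pos | apply exp_le_alpha; lra].
Qed.

Lemma tolerance_exp_increasing g x y :
  0 < g -> 1 < alp g -> x < y -> y <= ln (alp g) ->
  tolerance g (exp x) < tolerance g (exp y).
Proof.
  intros Hg Ha Hxy Hy; apply tolerance_increasing; try assumption.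
  - apply exp_pos.
  - apply exp_increasing, Hxy.
  - apply exp_le_alpha; lra.
Qed.

Lemma fbar_exp_increasing g beta a :
  0 < g -> 1 < alp g -> increasing_on
    (fun z => fbar mu eta sigma delta g beta (exp z)) a (ln (alp g)).
Proof.
  intros Hg Ha x y Hx Hxy Hy.
  apply (is_derive_pos_incr (fun z => fbar mu eta sigma delta g beta (exp z))
    (fun z => tolerance g (exp z))); [exact Hxy | |].
  - intros t _; apply is_derive_fbar_exp; assumption.
  - intros t Ht; apply tolerance_exp_pos; lra.
Qed.

(** * Existence of M-hat and the case gamma < gamma2 *)

(** In terms of the tolerance: it increases from a value below the cost at z = 1 to sigma^2/mu,
    which exceeds the cost by [cost_lt], at z = alpha. *)
Lemma Mhat_exists_unique g :
  0 < g -> 1 < alp g -> tolerance g 1 < cost ->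
  exists! M, 0 < M < ln (alp g) /\ Mhat_equation mu eta sigma delta g M.
Proof.
  intros Hg Ha H1.
  assert (Hl : 0 < ln (alp g)) by (rewrite <- ln_1; apply ln_increasing; lra).
  assert (Hend : tolerance g (exp (ln (alp g))) = sigma ^ 2 / mu)
    by (rewrite exp_ln by lra; apply tolerance_alpha; assumption).
  assert (Hlt := cost_lt).
  destruct (IVT_segment (fun z => tolerance g (exp z)) 0 (ln (alp g)) cost)
    as [M [HM E]].
  - lra.
  - intros x Hx; apply (continuous_comp exp (tolerance g)).
    + apply (is_derive_continuous _ _ _ (is_derive_exp x)).
    + apply continuous_tolerance; [assumption .. | apply exp_pos].
  - rewrite exp_0, Hend; lra.
  - assert (HM0 : M <> 0) by (intros ->; rewrite exp_0 in E; lra).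
    assert (HMl : M <> ln (alp g)) by (intros ->; rewrite Hend in E; lra).
    exists M; split.
    + split; [lra |]; apply Mhat_equation_iff; assumption.
    + intros M' [HM' E']; apply Mhat_equation_iff in E'; [| assumption ..].
      destruct (Rtotal_order M M') as [L | [L | L]]; [| exact L |].
      * assert (A := tolerance_exp_increasing g M M' Hg Ha L ltac:(lra)); lra.
      * assert (A := tolerance_exp_increasing g M' M Hg Ha L ltac:(lra)); lra.
Qed.

Lemma hat_case g M :
  0 < g -> 1 < alp g -> 0 < M < ln (alp g) -> tolerance g (exp M) = cost ->
  bijective_between (x2_hat mu eta sigma delta g M) M (ln (alp g))
    0 (x0 mu eta sigma delta g M) /\
  (exists v, is_candidate_hat mu eta sigma delta g M v) /\
  (forall v, is_candidate_hat mu eta sigma delta g M v ->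
     HJB_solution mu eta sigma delta g v /\
     b2_threshold v = Finite 0 /\
     ratio_decreasing_pos v /\
     b1_threshold mu sigma v
     = Finite (fhat mu eta sigma delta g (- M) (alp g))).
Proof.
  intros Hg Ha HM HE.
  set (psi := fun z => fbar mu eta sigma delta g (- M) (exp z)).
  set (x2 := x2_hat mu eta sigma delta g M).
  assert (Hx2 : forall z, x2 z = psi z)
    by (intros z; apply fhat_eq_fbar; assumption).
  assert (Hx0 : x0 mu eta sigma delta g M = psi (ln (alp g))).
  { unfold psi; rewrite exp_ln by lra; apply fhat_eq_fbar; assumption. }
  assert (Hpsi : forall z, is_derive psi z (tolerance g (exp z)))
    by (intros z; apply is_derive_fbar_exp; assumption).
  assert (HpsiM : psi M = 0).
  { unfold psi; rewrite <- (Ropp_involutive M) at 2; apply fbar_start. }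
  assert (Hinc : increasing_on psi M (ln (alp g)))
    by (apply fbar_exp_increasing; assumption).
  assert (Hinc2 : increasing_on x2 M (ln (alp g)))
    by (intros x y Hx Hxy Hy; rewrite !Hx2; apply Hinc; assumption).
  assert (Hbij : bijective_between x2 M (ln (alp g)) 0 (x0 mu eta sigma delta g M)).
  { rewrite Hx0, <- HpsiM, <- !Hx2.
    apply increasing_on_bijective; [lra | exact Hinc2 |].
    intros t _; apply (continuous_ext psi); [intros r; symmetry; apply Hx2 |].
    apply (is_derive_continuous _ _ _ (Hpsi t)). }
  assert (HX : 0 < psi (ln (alp g))) by (rewrite <- HpsiM; apply Hinc; lra).
  destruct (upper_solution g M 0 0 psi Hg Ha (proj2 HM) Hpsi HpsiM)
    as [V [D [S [[HC2 [HP Hrat]] [Hcurve [Htail [HrX [Hode1 Hode2]]]]]]]].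
  rewrite Rplus_0_r in *.
  (* At z = M the tolerance is the cost, and q/etabar - (mu - eta) vanishes. *)
  assert (HV0 : V 0 = 0).
  { destruct (Hcurve M ltac:(lra)) as [E _]; rewrite HpsiM, Rplus_0_r in E.
    rewrite E; unfold curve_value; rewrite HE, HpsiM.
    assert (Heb := etabar_pos); field; lra. }
  assert (HD0 : D 0 < 1).
  { destruct (Hcurve M ltac:(lra)) as [_ [E _]]; rewrite HpsiM, Rplus_0_r in E.
    rewrite E, <- exp_0; apply exp_increasing; lra. }
  assert (Hmid : forall x, 0 < x < psi (ln (alp g)) ->
    let z := x2_hat_inv mu eta sigma delta g M x in
    V x = exp (- z) / (delta + g)
          * (Defs.g mu sigma delta g (exp z) * exp z / eb
             * (c33 mu eta sigma delta g (- M)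
                - cost * H mu sigma delta g (- M) (exp z)) - (mu - eta))
          + g * x / (delta + g)).
  { intros x Hx z.
    destruct (proj2 Hbij x) as [t [[Ht Et] _]]; [rewrite Hx0; lra |].
    assert (Ez : z = t)
      by (unfold z, x2_hat_inv; rewrite <- Et; apply inverse_on_eq; assumption).
    rewrite Ez, (c33_eq_c31 g Hg Ha M HE).
    destruct (Hcurve t Ht) as [E _]; rewrite Rplus_0_r, <- Hx2, Et in E; rewrite E.
    rewrite Hx2 in Et; unfold curve_value; rewrite Et, Rplus_0_l.
    rewrite <- (density_c31_minus_H g Hg Ha (- M) (exp t) (exp_pos t)).
    assert (Heb := etabar_pos); field; lra. }
  assert (Htail' : forall x, psi (ln (alp g)) <= x ->
    V x = c32 mu eta sigma delta g (alp g) * exp (lam g * (x - psi (ln (alp g))))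
          + g / (g + delta) * (x + eta / (delta + g))).
  { intros x Hx; rewrite Htail by exact Hx; unfold tail_value.
    rewrite Rplus_0_r, Rminus_0_r; ring. }
  split; [exact Hbij | split].
  - exists V; unfold is_candidate_hat; rewrite Hx0.
    split; [exact HV0 |]; split; [exact Hmid |]; split.
    + intros x Hx; apply Htail'; lra.
    + apply (C2_on_continuous _ V D S _ HC2); lra.
  - intros v Hv; unfold is_candidate_hat in Hv; rewrite Hx0 in Hv.
    destruct Hv as [Hv0 [Hv1 [Hv2 Hvc]]].
    (* The candidate clauses determine v on the half-line, so the properties of V pass to every
       candidate. *)
    assert (Hagree : forall x, 0 <= x -> v x = V x).
    { assert (Hopen : forall x, 0 < x < psi (ln (alp g)) -> v x = V x)
        by (intros x Hx; rewrite (Hmid x Hx); apply Hv1, Hx).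
      intros x [Hx | <-]; [| congruence].
      destruct (Rtotal_order x (psi (ln (alp g)))) as [L | [-> | L]].
      - apply Hopen; lra.
      - apply (continuous_eq_left v V 0); [exact HX | exact Hopen | exact Hvc |].
        apply (C2_on_continuous _ V D S _ HC2); lra.
      - rewrite Htail' by lra; apply Hv2, L. }
    assert (Ef : fhat mu eta sigma delta g (- M) (alp g) = psi (ln (alp g)))
      by exact Hx0.
    rewrite Ef.
    apply (verification mu eta sigma delta g 0 (psi (ln (alp g))) V D S);
      try assumption; try lra.
    + intros x Hx; apply (HP x Hx).
    + intros x Hx; apply (HP x Hx).
    + intros x y Hx Hxy; apply Hrat; lra.
    + intros x Hx; unfold lump_gain; destruct (Rle_dec x 0); [lra |].
      rewrite HV0; apply Hode1; lra.
    + intros x Hx; unfold lump_gain; destruct (Rle_dec x 0); [lra |].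
      rewrite HV0; apply Hode2; lra.
Qed.

(** * The region below b2 and the case gamma > gamma2 *)

Section LowerRegion.

Variable gamma : R.
Hypothesis Hgamma : 0 < gamma.
Hypothesis Halpha : 1 < alp gamma.
Hypothesis Htol1 : cost < tolerance gamma 1.

Notation tol := (tolerance gamma).
Notation MM := (Mbar mu eta sigma delta gamma).
Notation C21 := (c21 mu eta sigma delta).
Notation r := (1 + delta * eb).

Lemma rate_pos : 0 < delta * eb.
Proof. apply Rmult_lt_0_compat; [exact Hdelta | exact etabar_pos]. Qed.

Lemma c21_eq : C21 * r = cost.
Proof. assert (A := rate_pos); unfold c21; field; lra. Qed.

Lemma c21_pos : 0 < C21.
Proof.
  assert (A := rate_pos); apply Rdiv_lt_0_compat; [exact cost_pos | lra].
Qed.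

Lemma H_at_1 : H mu sigma delta gamma 0 1 = 0.
Proof. unfold H; rewrite Ropp_0, exp_0, RInt_point; reflexivity. Qed.

Lemma density_c31_at_1 : g mu sigma delta gamma 1 * c31 mu eta sigma delta gamma 0 = tol 1.
Proof.
  rewrite <- (density_c31_minus_H gamma Hgamma Halpha 0 1 Rlt_0_1), H_at_1; ring.
Qed.

(** Since c21 (1 + delta etabar) is the cost, tolerance(1) > cost says that the argument of the
    logarithm in [Mbar] exceeds 1, whence M > 0. *)
Lemma tol1_gt : 1 < 1 / (delta * eb) * (tol 1 / C21 - 1).
Proof.
  assert (A := rate_pos); assert (B := c21_pos); assert (C := c21_eq).
  apply (Rmult_lt_reg_l (delta * eb * C21)); [nra |].
  replace (delta * eb * C21 * (1 / (delta * eb) * (tol 1 / C21 - 1)))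
    with (tol 1 - C21); [lra |].
  assert (Heb := etabar_pos); field; repeat split; lra.
Qed.

Lemma Mbar_arg :
  1 / (delta * eb) * (g mu sigma delta gamma 1 / C21 * c31 mu eta sigma delta gamma 0 - 1)
  = 1 / (delta * eb) * (tol 1 / C21 - 1).
Proof. rewrite <- density_c31_at_1; unfold Rdiv; ring. Qed.

Lemma Mbar_pos : 0 < MM.
Proof.
  unfold Mbar; rewrite Mbar_arg; assert (A := rate_pos).
  apply Rmult_lt_0_compat; [apply Rdiv_lt_0_compat; lra |].
  rewrite <- ln_1; apply ln_increasing; [lra | exact tol1_gt].
Qed.

(** Solution of the ODE with gamma = 0 in the variable -ln v': [c21] is its stationary solution and
    r its growth rate. The value at -M is the cost, as v(0) = 0 requires, and M is the length after
    which it reaches tolerance(1). *)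
Definition lower_tolerance (z : R) : R := C21 * (1 + delta * eb * exp (r * (z + MM))).

(** Again the optimised equation solved for v, here delta v = v' (q/etabar - (mu - eta)). *)
Definition lower_value (z : R) : R := C21 * exp (- z) * (exp (r * (MM + z)) - 1).

Lemma lower_tolerance_0 : lower_tolerance 0 = tol 1.
Proof.
  assert (A := rate_pos); assert (B := c21_pos); assert (C := tol1_gt).
  unfold lower_tolerance, Mbar; rewrite Mbar_arg.
  set (a := 1 / (delta * eb) * (tol 1 / C21 - 1)) in *.
  replace (r * (0 + 1 / r * ln a)) with (ln a) by (field; lra).
  rewrite exp_ln by lra; unfold a.
  assert (Heb := etabar_pos); field; repeat split; lra.
Qed.

Lemma lower_tolerance_pos z : 0 < lower_tolerance z.
Proof.
  assert (A := rate_pos); assert (B := exp_pos (r * (z + MM))).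
  apply Rmult_lt_0_compat; [exact c21_pos | nra].
Qed.

Lemma is_derive_x1 z :
  is_derive (x1 mu eta sigma delta gamma) z (lower_tolerance z).
Proof.
  assert (A := rate_pos); unfold x1, lower_tolerance.
  auto_derive; [exact I |]; field; lra.
Qed.

Lemma is_derive_lower_value z :
  is_derive lower_value z (exp (- z) * lower_tolerance z).
Proof.
  unfold lower_value, lower_tolerance; auto_derive; [exact I |].
  rewrite (Rplus_comm MM z); ring.
Qed.

Lemma x1_start : x1 mu eta sigma delta gamma (- MM) = 0.
Proof.
  assert (A := rate_pos); unfold x1; rewrite Rplus_opp_l, Rmult_0_r, exp_0.
  field; lra.
Qed.

Lemma x1_end : x1 mu eta sigma delta gamma 0 = b2 mu eta sigma delta gamma.
Proof.
  assert (A := rate_pos); unfold x1, b2.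
  rewrite Rplus_0_l, (Rmult_comm r MM); field; lra.
Qed.

Lemma x1_increasing a : increasing_on (x1 mu eta sigma delta gamma) a 0.
Proof.
  intros x y Hx Hxy Hy.
  apply (is_derive_pos_incr _ lower_tolerance); [exact Hxy | |];
    intros t Ht; [apply is_derive_x1 | apply lower_tolerance_pos].
Qed.

Lemma lower_solution :
  exists V D S,
    risk_averse_on (fun x => 0 <= x <= b2 mu eta sigma delta gamma) V D S /\
    forall z, - MM <= z <= 0 ->
      V (x1 mu eta sigma delta gamma z) = lower_value z /\
      D (x1 mu eta sigma delta gamma z) = exp (- z) /\
      S (x1 mu eta sigma delta gamma z) = - (exp (- z) / lower_tolerance z).
Proof.
  assert (HM := Mbar_pos).
  assert (Hex := risk_averse_parametric_curve (x1 mu eta sigma delta gamma)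
    lower_tolerance lower_value (- MM - 1) (- MM) 0 1).
  rewrite x1_start, x1_end in Hex; apply Hex; try lra.
  - intros z _; apply is_derive_x1.
  - intros z _; apply lower_tolerance_pos.
  - intros z _; apply (ex_derive_continuous lower_tolerance); unfold lower_tolerance.
    auto_derive; exact I.
  - intros z _; apply is_derive_lower_value.
  - intros x y _ Hxy _; unfold lower_tolerance; assert (A := rate_pos).
    assert (exp (r * (x + MM)) < exp (r * (y + MM))) by (apply exp_increasing; nra).
    apply Rmult_lt_compat_l; [exact c21_pos | nra].
Qed.

Lemma lower_ode z :
  - (mu ^ 2 / (2 * sigma ^ 2)) * (exp (- z) ^ 2 / - (exp (- z) / lower_tolerance z))
  - (mu - eta) * exp (- z) - delta * lower_value z = 0.
Proof.
  assert (He := exp_pos (- z)); assert (A := rate_pos); assert (Heb := etabar_pos).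
  replace (exp (- z) ^ 2 / - (exp (- z) / lower_tolerance z))
    with (- (exp (- z) * lower_tolerance z))
    by (unfold Rdiv; rewrite Rinv_opp, Rinv_mult, Rinv_inv; field; lra).
  replace (mu ^ 2 / (2 * sigma ^ 2)) with (/ eb) by (unfold etabar; field; lra).
  replace (mu - eta) with (C21 * r / eb) by (rewrite c21_eq; field; lra).
  unfold lower_value, lower_tolerance; rewrite (Rplus_comm MM z); field; lra.
Qed.

Lemma b2_pos : 0 < b2 mu eta sigma delta gamma.
Proof.
  assert (HM := Mbar_pos).
  assert (A := x1_increasing (- MM) (- MM) 0 ltac:(lra) ltac:(lra) ltac:(lra)).
  rewrite x1_start, x1_end in A; exact A.
Qed.

(** At b2 the lump gain is zero, so the equations on both sides coincide there; equal slope and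
    equal tolerance then force equal values. *)
Lemma curve_lower_fit (psi : R -> R) :
  psi 0 = 0 -> curve_value gamma (lower_value 0) psi 0 = lower_value 0.
Proof.
  intros Hpsi; assert (A := rate_pos); assert (Heb := etabar_pos).
  unfold curve_value; rewrite Hpsi, Ropp_0, exp_0, <- lower_tolerance_0.
  assert (E : delta * lower_value 0 = lower_tolerance 0 / eb - (mu - eta)).
  { replace (mu - eta) with (C21 * r / eb) by (rewrite c21_eq; field; lra).
    unfold lower_value, lower_tolerance; rewrite Ropp_0, exp_0, (Rplus_comm MM 0).
    field; lra. }
  rewrite <- E; field; lra.
Qed.

End LowerRegion.

Lemma bar_case gm :
  0 < gm -> 1 < alp gm -> cost < tolerance gm 1 ->
  0 < Mbar mu eta sigma delta gm /\
  bijective_between (x1 mu eta sigma delta gm)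
    (- Mbar mu eta sigma delta gm) 0 0 (b2 mu eta sigma delta gm) /\
  bijective_between (x2_bar mu eta sigma delta gm)
    0 (ln (alp gm)) (b2 mu eta sigma delta gm) (xb2 mu eta sigma delta gm) /\
  (exists v, is_candidate_bar mu eta sigma delta gm v) /\
  (forall v, is_candidate_bar mu eta sigma delta gm v ->
     C2_pos v /\ increasing_pos v /\ concave_pos v /\
     HJB_solution mu eta sigma delta gm v /\
     b2_threshold v = Finite (b2 mu eta sigma delta gm) /\
     ratio_decreasing_pos v /\
     b1_threshold mu sigma v
     = Finite (fbar mu eta sigma delta gm 0 (alp gm) + b2 mu eta sigma delta gm)).
Proof.
  intros Hg Ha H1.
  assert (HM := Mbar_pos gm Hg Ha H1).
  assert (Hs := x1_start gm); assert (He := x1_end gm).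
  assert (Hb2 := b2_pos gm Hg Ha H1).
  assert (Hi1 := x1_increasing gm (- Mbar mu eta sigma delta gm)).
  set (M := Mbar mu eta sigma delta gm) in *.
  set (B := b2 mu eta sigma delta gm) in *.
  set (psi := fun z => fbar mu eta sigma delta gm 0 (exp z)).
  assert (Hl : 0 < ln (alp gm)) by (rewrite <- ln_1; apply ln_increasing; lra).
  assert (Hpsi : forall z, is_derive psi z (tolerance gm (exp z)))
    by (intros z; apply is_derive_fbar_exp; assumption).
  assert (Hpsi0 : psi 0 = 0).
  { assert (E := fbar_start gm 0); rewrite Ropp_0 in E; exact E. }
  assert (Hxb2 : xb2 mu eta sigma delta gm = psi (ln (alp gm)) + B)
    by (unfold psi; rewrite exp_ln by lra; reflexivity).
  assert (Hinc2 : increasing_on (x2_bar mu eta sigma delta gm) 0 (ln (alp gm))).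
  { intros x y Hx Hxy Hy; apply Rplus_lt_compat_r.
    apply (fbar_exp_increasing gm 0 0); assumption. }
  assert (Hbij1 : bijective_between (x1 mu eta sigma delta gm) (- M) 0 0 B).
  { assert (Hbij := increasing_on_bijective (x1 mu eta sigma delta gm) (- M) 0
      ltac:(lra) Hi1); rewrite Hs, He in Hbij; apply Hbij.
    intros t _; apply (is_derive_continuous _ _ _ (is_derive_x1 gm t)). }
  assert (Hx2 : forall z, x2_bar mu eta sigma delta gm z = psi z + B) by reflexivity.
  assert (Hbij2 : bijective_between (x2_bar mu eta sigma delta gm) 0 (ln (alp gm))
                    B (xb2 mu eta sigma delta gm)).
  { assert (Hbij := increasing_on_bijective (x2_bar mu eta sigma delta gm) 0
      (ln (alp gm)) ltac:(lra) Hinc2).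
    rewrite !Hx2, Hpsi0, Rplus_0_l, <- Hxb2 in Hbij; apply Hbij.
    intros t _; apply (continuous_plus psi); [| apply continuous_const].
    apply (is_derive_continuous _ _ _ (Hpsi t)). }
  assert (HX : B < psi (ln (alp gm)) + B).
  { assert (A := Hinc2 0 (ln (alp gm)) ltac:(lra) Hl ltac:(lra)).
    rewrite !Hx2, Hpsi0 in A; lra. }
  set (X := psi (ln (alp gm)) + B) in *.
  destruct (lower_solution gm Hg Ha H1) as [V1 [D1 [S1 [HR1 Hc1]]]].
  destruct (upper_solution gm 0 B (lower_value gm 0) psi Hg Ha Hl Hpsi Hpsi0)
    as [V2 [D2 [S2 [HR2 [Hc2 [Htail [HrX [Hode1 Hode2]]]]]]]].
  fold M B X in HR1, HR2, Htail, HrX, Hode1, Hode2, Hc1.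
  destruct (Hc1 0 ltac:(lra)) as [FV1 [FD1 FS1]].
  destruct (Hc2 0 ltac:(lra)) as [FV2 [FD2 FS2]].
  rewrite He in FV1, FD1, FS1; rewrite Hpsi0, Rplus_0_l in FV2, FD2, FS2.
  rewrite (curve_lower_fit gm Hg Ha H1 psi Hpsi0) in FV2.
  rewrite exp_0, <- (lower_tolerance_0 gm Hg Ha H1) in FS2.
  (* At b2 both curves have parameter 0, hence slope 1; the values agree by [curve_lower_fit] and
     the curvatures by [lower_tolerance_0]. *)
  assert (EV : V1 B = V2 B) by congruence.
  assert (ED : D1 B = D2 B) by congruence.
  assert (ES : S1 B = S2 B) by congruence.
  assert (HR := risk_averse_glue 0 B V1 D1 S1 V2 D2 S2 ltac:(lra) EV ED ES HR1 HR2).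
  assert (HL : forall x, x <= B -> glue B V1 V2 x = V1 x /\ glue B D1 D2 x = D1 x
                                   /\ glue B S1 S2 x = S1 x).
  { intros x Hx; rewrite !glue_left by exact Hx; auto. }
  assert (HU : forall x, B <= x -> glue B V1 V2 x = V2 x /\ glue B D1 D2 x = D2 x
                                   /\ glue B S1 S2 x = S2 x).
  { intros x Hx; rewrite !glue_right by assumption; auto. }
  set (V := glue B V1 V2) in *; set (D := glue B D1 D2) in *; set (S := glue B S1 S2) in *.
  destruct HR as [HC2 [HP Hrat]].
  assert (HVB : V B = lower_value gm 0) by (destruct (HL B ltac:(lra)) as [-> _]; exact FV1).
  assert (HDB : D B = 1).
  { destruct (HL B ltac:(lra)) as [_ [-> _]]; rewrite FD1, Ropp_0; apply exp_0. }
  assert (HV0 : V 0 = 0).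
  { destruct (HL 0 ltac:(lra)) as [-> _].
    destruct (Hc1 (- M) ltac:(lra)) as [E _]; rewrite Hs in E; rewrite E.
    unfold lower_value; fold M; rewrite Rplus_opp_r, Rmult_0_r, exp_0; ring. }
  assert (Hlow : forall x, 0 < x < B ->
    let z := x1_inv mu eta sigma delta gm x in
    V x = c21 mu eta sigma delta * exp (- z) * (exp ((1 + delta * eb) * (M + z)) - 1)).
  { intros x Hx z.
    destruct (proj2 Hbij1 x) as [t [[Ht Et] _]]; [lra |].
    assert (Ez : z = t)
      by (unfold z, x1_inv; rewrite <- Et; apply inverse_on_eq; assumption).
    destruct (HL x ltac:(lra)) as [-> _]; rewrite Ez, <- Et.
    exact (proj1 (Hc1 t Ht)). }
  assert (Hmid : forall x, B < x < X ->
    let z := x2_bar_inv mu eta sigma delta gm x in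
    V x = exp (- z) / (delta + gm)
          * (g mu sigma delta gm (exp z) * exp z / eb
             * (c31 mu eta sigma delta gm 0 - cost * H mu sigma delta gm 0 (exp z))
             - (mu - eta))
          + gm * (V B + x - B) / (delta + gm)).
  { intros x Hx z.
    destruct (proj2 Hbij2 x) as [t [[Ht Et] _]]; [rewrite Hxb2; lra |].
    assert (Ez : z = t)
      by (unfold z, x2_bar_inv; rewrite <- Et; apply inverse_on_eq; assumption).
    destruct (HU x ltac:(lra)) as [E _]; rewrite E, Ez, HVB, <- Et, Hx2.
    rewrite (proj1 (Hc2 t Ht)); unfold curve_value.
    rewrite <- (density_c31_minus_H gm Hg Ha 0 (exp t) (exp_pos t)).
    assert (Heb := etabar_pos); field; lra. }
  assert (Htail' : forall x, X <= x ->
    V x = c32 mu eta sigma delta gm (alp gm) * exp (lam gm * (x - X))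
          + gm / (gm + delta) * (x - B + V B + eta / (delta + gm))).
  { intros x Hx; destruct (HU x ltac:(lra)) as [E _].
    rewrite E, Htail, HVB by exact Hx; reflexivity. }
  assert (HVc : forall x, 0 <= x -> continuous V x)
    by (intros x Hx; apply (C2_on_continuous _ V D S _ HC2), Hx).
  split; [exact HM | split; [exact Hbij1 | split; [exact Hbij2 | split]]].
  - exists V; unfold is_candidate_bar; fold B M; rewrite Hxb2.
    split; [exact HV0 |]; split; [exact Hlow |]; split; [exact Hmid |]; split.
    + intros x Hx; apply Htail'; lra.
    + split; apply HVc; lra.
  - intros v Hv; unfold is_candidate_bar in Hv; fold B M in Hv; rewrite Hxb2 in Hv.
    destruct Hv as [Hv0 [Hv1 [Hv2 [Hv3 [HvcB HvcX]]]]].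
    assert (Hagree : forall x, 0 <= x -> v x = V x).
    { assert (A1 : forall x, 0 < x < B -> v x = V x)
        by (intros x Hx; rewrite (Hlow x Hx); apply Hv1, Hx).
      (* Needed before the middle region, whose formula contains v(b2) itself. *)
      assert (AB : v B = V B).
      { apply (continuous_eq_left v V 0); [lra | exact A1 | exact HvcB | apply HVc; lra]. }
      assert (A2 : forall x, B < x < X -> v x = V x)
        by (intros x Hx; rewrite (Hmid x Hx), <- AB; apply Hv2, Hx).
      assert (AX : v X = V X).
      { apply (continuous_eq_left v V B); [lra | exact A2 | exact HvcX | apply HVc; lra]. }
      intros x [Hx | <-]; [| congruence].
      destruct (Rtotal_order x B) as [L | [-> | L]]; [apply A1; lra | exact AB |].
      destruct (Rtotal_order x X) as [L' | [-> | L']]; [apply A2; lra | exact AX |].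
      rewrite Htail', <- AB by lra; apply Hv3, L'. }
    assert (Ef : fbar mu eta sigma delta gm 0 (alp gm) + B = X) by exact Hxb2.
    rewrite Ef.
    apply (verification mu eta sigma delta gm B X V D S); try assumption; try lra.
    + intros x Hx; apply (HP x Hx).
    + intros x Hx; apply (HP x Hx).
    + intros x y Hx Hxy; apply Hrat; lra.
    + destruct (HU X ltac:(lra)) as [_ [-> ->]]; exact HrX.
    + intros x Hx; unfold lump_gain; destruct (Rle_dec x B).
      * destruct (HL x ltac:(lra)) as [-> [-> ->]].
        destruct (proj2 Hbij1 x) as [t [[Ht <-] _]]; [lra |].
        destruct (Hc1 t Ht) as [-> [-> ->]].
        rewrite Rmult_0_r, Rplus_0_r; apply lower_ode; assumption.
      * rewrite HVB; destruct (HU x ltac:(lra)) as [-> [-> ->]]; apply Hode1; lra.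
    + intros x Hx; unfold lump_gain; destruct (Rle_dec x B); [lra |].
      rewrite HVB; destruct (HU x ltac:(lra)) as [-> [-> ->]]; apply Hode2; lra.
Qed.

End Model.

Theorem proposition3p10 :
  forall mu eta sigma delta gamma2 : R,
  0 < eta -> 0 < sigma -> 0 < delta ->
  eta < mu < 2 * eta ->
  0 < gamma2 < gamma1 mu eta sigma delta ->
  f3 mu eta sigma delta gamma2 = f4 mu eta sigma gamma2 ->
  (forall gamma : R,
     gamma2 < gamma < gamma1 mu eta sigma delta ->
     0 < Mbar mu eta sigma delta gamma /\
     bijective_between (x1 mu eta sigma delta gamma)
       (- Mbar mu eta sigma delta gamma) 0
       0 (b2 mu eta sigma delta gamma) /\
     bijective_between (x2_bar mu eta sigma delta gamma)
       0 (ln (alpha mu eta sigma delta gamma))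
       (b2 mu eta sigma delta gamma) (xb2 mu eta sigma delta gamma) /\
     (exists v : R -> R, is_candidate_bar mu eta sigma delta gamma v) /\
     (forall v : R -> R,
        is_candidate_bar mu eta sigma delta gamma v ->
        C2_pos v /\
        increasing_pos v /\
        concave_pos v /\
        HJB_solution mu eta sigma delta gamma v /\
        b2_threshold v = Finite (b2 mu eta sigma delta gamma) /\
        ratio_decreasing_pos v /\
        b1_threshold mu sigma v
        = Finite (fbar mu eta sigma delta gamma 0
                    (alpha mu eta sigma delta gamma)
                  + b2 mu eta sigma delta gamma)))
  /\
  (forall gamma : R,
     0 < gamma < gamma2 ->
     (exists! M : R,
        0 < M < ln (alpha mu eta sigma delta gamma) /\
        Mhat_equation mu eta sigma delta gamma M) /\
     (forall M : R,
        0 < M < ln (alpha mu eta sigma delta gamma) ->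
        Mhat_equation mu eta sigma delta gamma M ->
        bijective_between (x2_hat mu eta sigma delta gamma M)
          M (ln (alpha mu eta sigma delta gamma))
          0 (x0 mu eta sigma delta gamma M) /\
        (exists v : R -> R, is_candidate_hat mu eta sigma delta gamma M v) /\
        (forall v : R -> R,
           is_candidate_hat mu eta sigma delta gamma M v ->
           HJB_solution mu eta sigma delta gamma v /\
           b2_threshold v = Finite 0 /\
           ratio_decreasing_pos v /\
           b1_threshold mu sigma v
           = Finite (fhat mu eta sigma delta gamma (- M)
                       (alpha mu eta sigma delta gamma))))).

Proof.
  intros mu eta sigma delta gamma2 Heta Hsigma Hdelta Hmu Hg2 Hf.
  assert (Ht2 := tolerance_1_gamma2 mu eta sigma delta Heta Hsigma Hdelta Hmu gamma2 Hg2 Hf).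
  split; intros gamma Hg.
  - apply bar_case; try assumption; try lra.
    + apply alpha_gt_1; try assumption; lra.
    + rewrite <- Ht2; apply tolerance_1_increasing; assumption || lra.
  - assert (Ha : 1 < alpha mu eta sigma delta gamma)
      by (apply alpha_gt_1; try assumption; lra).
    assert (Ht : tolerance mu eta sigma delta gamma 1 < etabar mu sigma * (mu - eta))
      by (rewrite <- Ht2; apply tolerance_1_increasing; assumption || lra).
    split; [apply Mhat_exists_unique; try assumption; lra |].
    intros M HM HE; apply hat_case; try assumption; [lra |].
    apply Mhat_equation_iff in HE; try assumption; lra.
Qed.
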